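(* Let $k>0$, $c\in\mathbb{R}$, $x>0$, and let $\alpha,\lambda,v\in\mathbb{C}$ be such that $\Re(v)>-1$, $0<\Re(\alpha)<1-\Re(\lambda-v)$ and $\frac{\lambda}{k}-\frac{v}{k}+\alpha\notin\{1,2,\dots\}$, and suppose that none of the three lower parameters of the ${}_2F_3$ below is in $\{0,-1,-2,\dots\}$. Then $$\left(I_{-}^{\alpha}\,t^{\frac{\lambda}{k}-1}W_{v,c}^{k}\left(\tfrac1t\right)\right)(x)=\frac{x^{\frac{\lambda}{k}-\frac{v}{k}+\alpha-1}}{(2k)^{\frac{v}{k}}}\,\frac{\Gamma\left(1-\alpha-\frac{\lambda}{k}+\frac{v}{k}\right)}{\Gamma\left(1-\frac{\lambda}{k}+\frac{v}{k}\right)\Gamma\left(\frac{v}{k}+1\right)}\;{}_2F_3\left[\begin{array}{c}\frac{-\alpha+1}{2}-\frac{\lambda}{2k}+\frac{v}{2k},\ \frac{-\alpha+2}{2}-\frac{\lambda}{2k}+\frac{v}{2k}\\ \frac{v}{k}+1,\ \frac12-\frac{\lambda}{2k}+\frac{v}{2k},\ 1-\frac{\lambda}{2k}+\frac{v}{2k}\end{array};-\frac{c}{4kx^2}\right].$$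
   Context: The right-sided Riemann–Liouville fractional integral of order $\alpha\in\mathbb{C}$, $\Re(\alpha)>0$, is, for $x>0$, $$\left(I_{-}^{\alpha}f\right)(x)=\frac{1}{\Gamma(\alpha)}\int_x^\infty (t-x)^{\alpha-1}f(t)\,dt.$$ The notation $\left(I_{-}^{\alpha}g(t)\right)(x)$ means the operator applied to $t\mapsto g(t)$ on $(0,\infty)$ and evaluated at $x$. The $k$-Bessel function is $$W_{v,c}^{k}(z)=\sum_{n=0}^{\infty}\frac{(-c)^n}{\Gamma_k(nk+v+k)\,n!}\left(\frac{z}{2}\right)^{2n+\frac{v}{k}},$$ where $\Gamma_k(z)=\int_0^\infty t^{z-1}e^{-t^k/k}\,dt$ for $\Re(z)>0$, extended by $\Gamma_k(z)=k^{\frac{z}{k}-1}\Gamma\left(\frac{z}{k}\right)$. The generalized hypergeometric function is $${}_pF_q\left[\begin{array}{c}a_1,\dots,a_p\\ b_1,\dots,b_q\end{array};z\right]=\sum_{n=0}^\infty\frac{(a_1)_n\cdots(a_p)_n}{(b_1)_n\cdots(b_q)_n}\frac{z^n}{n!},\qquad b_j\ne0,-1,-2,\dots,$$ where $(a)_n$ is the Pochhammer symbol. Complex powers of positive reals are $y^s=e^{s\log y}$.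
   Formalization: The stated bound Re(α)<1−Re(λ−v) does not ensure convergence when k≠1, so the identity is proved whenever the integral on the left converges absolutely, and such convergence is proved when Re(λ/k−v/k+α)<1. *)

(* Defs.v *)
From HB Require Import structures.
From mathcomp Require Import all_boot all_order all_algebra complex.
From mathcomp Require Import all_classical all_reals all_analysis.

Set Implicit Arguments.
Unset Strict Implicit.
Unset Printing Implicit Defensive.

Import Order.TTheory GRing.Theory Num.Theory.
Import numFieldNormedType.Exports.

Local Open Scope classical_set_scope.
Local Open Scope ring_scope.
Local Open Scope complex_scope.

Section ComplexAnalysis.
Variable R : realType.

Definition cexp (z : R[i]) : R[i] :=
  (expR (complex.Re z))%:C * (cos (complex.Im z) +i* sin (complex.Im z)).

(* Only meaningful for 0 < y. *)
Definition cpow (y : R) (s : R[i]) : R[i] := cexp (s * (ln y)%:C).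

Definition cintegrable (D : set R) (f : R -> R[i]) : Prop :=
  lebesgue_measure.-integrable D (fun t => (complex.Re (f t))%:E) /\
  lebesgue_measure.-integrable D (fun t => (complex.Im (f t))%:E).

(* Only meaningful when cintegrable D f. *)
Definition cintegral (D : set R) (f : R -> R[i]) : R[i] :=
  Rintegral lebesgue_measure D (fun t => complex.Re (f t)) +i*
  Rintegral lebesgue_measure D (fun t => complex.Im (f t)).

(* R[i] carries no canonical topology in the libraries, so the sum of a
   complex series is taken componentwise. *)
Definition csum (u : nat -> R[i]) : R[i] :=
  limn (series (fun n => complex.Re (u n))) +i*
  limn (series (fun n => complex.Im (u n))).

Definition pochhammer (a : R[i]) (n : nat) : R[i] :=
  \prod_(i < n) (a + i%:R).

(* Euler's integral on the half-plane 0 < Re z, continued to the rest of the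
   plane by Gamma(z) = Gamma(z + N) / (z)_N, where N is the least positive
   integer with 0 < Re (z + N).  At the poles 0, -1, -2, ... the value is 0,
   as division by 0 yields 0. *)
Definition Gamma_int (z : R[i]) : R[i] :=
  cintegral `]0, +oo[ (fun t => cpow t (z - 1) * (expR (- t))%:C).

Definition Gamma (z : R[i]) : R[i] :=
  if 0 < complex.Re z then Gamma_int z
  else let N := (Num.truncn (- complex.Re z)).+1 in
       Gamma_int (z + N%:R) / pochhammer z N.

Definition kGamma (k : R) (z : R[i]) : R[i] :=
  if 0 < complex.Re z then
    cintegral `]0, +oo[
      (fun t => cpow t (z - 1) * (expR (- (t `^ k / k)))%:C)
  else cpow k (z / k%:C - 1) * Gamma (z / k%:C).

(* W_{v,c}^k on the positive half-line. *)
Definition kBessel (k c : R) (v : R[i]) (z : R) : R[i] :=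
  csum (fun n =>
    ((- c) ^+ n)%:C / (kGamma k (n%:R * k%:C + v + k%:C) * (n`!)%:R)
    * cpow (z / 2) ((2 * n)%:R + v / k%:C)).

Definition hypergeometric (a b : seq R[i]) (z : R[i]) : R[i] :=
  csum (fun n =>
    (\prod_(ai <- a) pochhammer ai n) / (\prod_(bj <- b) pochhammer bj n)
    * (z ^+ n / (n`!)%:R)).

Definition RL_right_integrand (alpha : R[i]) (f : R -> R[i]) (x t : R) : R[i] :=
  cpow (t - x) (alpha - 1) * f t.

(* The integral defining (I_-^alpha f)(x) converges absolutely. *)
Definition RL_right_defined (alpha : R[i]) (f : R -> R[i]) (x : R) : Prop :=
  cintegrable `]x, +oo[ (RL_right_integrand alpha f x).

Definition RL_right (alpha : R[i]) (f : R -> R[i]) (x : R) : R[i] :=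
  (Gamma alpha)^-1 * cintegral `]x, +oo[ (RL_right_integrand alpha f x).

Definition nonpositive_integer (b : R[i]) : Prop := exists n : nat, b = - n%:R.

End ComplexAnalysis.

(* Main.v *)
Require Import Defs.
From HB Require Import structures.
From mathcomp Require Import all_boot all_order all_algebra complex.
From mathcomp Require Import all_classical all_reals all_analysis.
From mathcomp Require Import measurable_realfun ring lra.

Set Implicit Arguments.
Unset Strict Implicit.
Unset Printing Implicit Defensive.

Import Order.TTheory GRing.Theory Num.Theory.
Import numFieldNormedType.Exports.
Import ComplexField.Normc.

Local Open Scope classical_set_scope.
Local Open Scope ring_scope.
Local Open Scope complex_scope.

Local Notation Re := complex.Re.
Local Notation Im := complex.Im.

(** Write nu = v / k, a = lambda / k, s = 1 - alpha - a + nu and b = s + alpha.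
    The k-Bessel function at 1 / t is the series
    K t^(- nu) * sum_n B_n t^(- 2 n), where B_n decays faster than any geometric
    sequence, so the integrand of the fractional integral is a series of multiples
    of (t - x)^(alpha - 1) * t^(- (s + 2 n) - alpha).  The integral of each of
    these terms over (x, oo) is a beta integral, with value
    x^(- (s + 2 n)) Gamma(alpha) Gamma(s + 2 n) / Gamma(b + 2 n)
    ([cintegral_beta]).  For t > x the partial sums are dominated by a multiple of
    the modulus of the term of index 0, so the series may be integrated term by
    term when Re s > 0 ([RL_bessel_ccvg]); the duplication formula for Pochhammer
    symbols turns the resulting ratios into the coefficients of 2F3
    ([RL_bessel]).  When Re s <= 0 the leading term prevails for large t, the
    modulus of the integrand is at least a multiple of 1 / t, and the integral
    does not converge ([RL_bessel_undefined]); hence the formula has to be proved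
    only for Re s > 0.

    The facts about Gamma come from one integral, that of
    (t - x)^(z - 1) exp (- p (t - x)^k) over (x, oo) ([cintegral_stretched]).
    Writing exp (- q) as the integral of exp (- y) over y >= q and exchanging the
    integrals reduces it to Euler's integral at z / k + 1.  Special cases are
    Gamma(z + 1) = z Gamma(z), the relation between the k-Gamma function and
    Gamma, and the Laplace transform of a power; the latter, used twice inside a
    double integral, gives the beta integral.

    Division by Gamma values requires that Gamma has no zero
    ([Gamma_int_neq0]).  By the beta identity with both arguments z / 2, a zero z
    would give the zeros z / 2, z / 4, ..., hence zeros z / 2^n + 1 tending to 1,
    whereas Gamma(1) = 1. *)

(** * Complex numbers and complex powers of positive reals *)

Section ComplexPowers.
Variable R : realType.
Implicit Types (z w s : R[i]) (x y r : R).

Lemma ReD z w : Re (z + w) = Re z + Re w.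
Proof. by case: z w => [a b] [c d]. Qed.

Lemma ImD z w : Im (z + w) = Im z + Im w.
Proof. by case: z w => [a b] [c d]. Qed.

Lemma ReN z : Re (- z) = - Re z.
Proof. by case: z. Qed.

Lemma ImN z : Im (- z) = - Im z.
Proof. by case: z. Qed.

Lemma ReM z w : Re (z * w) = Re z * Re w - Im z * Im w.
Proof. by case: z w => [a b] [c d]. Qed.

Lemma ImM z w : Im (z * w) = Re z * Im w + Im z * Re w.
Proof. by case: z w => [a b] [c d]. Qed.

Lemma Re_sum (I : Type) (l : seq I) (P : pred I) (F : I -> R[i]) :
  Re (\sum_(i <- l | P i) F i) = \sum_(i <- l | P i) Re (F i).
Proof. exact: (big_morph _ ReD). Qed.

Lemma Im_sum (I : Type) (l : seq I) (P : pred I) (F : I -> R[i]) :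
  Im (\sum_(i <- l | P i) F i) = \sum_(i <- l | P i) Im (F i).
Proof. exact: (big_morph _ ImD). Qed.

Lemma natrC n : n%:R = (n%:R : R)%:C :> R[i].
Proof. by rewrite rmorph_nat. Qed.

Lemma Re_natr n : Re (n%:R : R[i]) = n%:R.
Proof. by rewrite natrC. Qed.

Lemma ReMC r z : Re (r%:C * z) = r * Re z.
Proof. by rewrite ReM mul0r subr0. Qed.

Lemma ImMC r z : Im (r%:C * z) = r * Im z.
Proof. by rewrite ImM mul0r addr0. Qed.

Lemma Re_divC r z : Re (z / r%:C) = Re z / r.
Proof. by rewrite -fmorphV mulrC ReMC mulrC. Qed.

Lemma complexP z w : Re z = Re w -> Im z = Im w -> z = w.
Proof. by case: z w => [a b] [c d] /= -> ->. Qed.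

Lemma normc_ge0 z : 0 <= normc z.
Proof. by case: z => a b; exact: sqrtr_ge0. Qed.

Lemma normc_Re z : `|Re z| <= normc z.
Proof. by case: z => a b /=; rewrite -sqrtr_sqr ler_wsqrtr// lerDl sqr_ge0. Qed.

Lemma normc_Im z : `|Im z| <= normc z.
Proof. by case: z => a b /=; rewrite -sqrtr_sqr ler_wsqrtr// lerDr sqr_ge0. Qed.

Lemma normcC r : normc r%:C = `|r|.
Proof. by rewrite /= expr0n addr0 sqrtr_sqr. Qed.

Lemma normc_triangle z w : normc (z + w) <= normc z + normc w.
Proof. exact: le_normcD. Qed.

Lemma normc_le_ReIm z : normc z <= `|Re z| + `|Im z|.
Proof.
rewrite -[z]/(z : Rcomplex R) {1}(complexE z) (le_trans (normc_triangle _ _))//.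
rewrite normcM !normcC.
by rewrite (_ : normc 'i = 1) ?mul1r//= expr0n add0r expr1n sqrtr1.
Qed.

Lemma normc_sum (I : Type) (l : seq I) (F : I -> R[i]) :
  normc (\sum_(i <- l) F i) <= \sum_(i <- l) normc (F i).
Proof.
elim/big_ind2 : _ => //; first by rewrite normc0.
by move=> z r w q zr wq; rewrite (le_trans (normc_triangle _ _))// lerD.
Qed.

Lemma normc_gt0 z : z != 0 -> 0 < normc z.
Proof.
move=> z0; rewrite lt_neqAle normc_ge0 andbT eq_sym.
by apply: contra z0 => /eqP/eq0_normc ->.
Qed.

Lemma normc_cexp z : normc (cexp z) = expR (Re z).
Proof.
rewrite normcM normcC ger0_norm ?expR_ge0//=.
by rewrite cos2Dsin2 sqrtr1 mulr1.
Qed.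

Lemma cexp0 : cexp 0 = 1 :> R[i].
Proof. by rewrite /cexp expR0 cos0 sin0 mul1r. Qed.

Lemma cexpD z w : cexp (z + w) = cexp z * cexp w.
Proof.
rewrite /cexp ReD ImD expRD cosD sinD.
by apply: complexP; rewrite !(ReM, ImM)/=; ring.
Qed.

Lemma cexp_neq0 z : cexp z != 0.
Proof.
apply/eqP => z0; have := normc_cexp z.
by rewrite z0 normc0 => /eqP; rewrite eq_sym expR_eq0.
Qed.

Lemma cpow0 y : cpow y 0 = 1.
Proof. by rewrite /cpow mul0r cexp0. Qed.

Lemma cpow1 s : cpow 1 s = 1 :> R[i].
Proof. by rewrite /cpow ln1 mulr0 cexp0. Qed.

Lemma cpowD y s z : cpow y (s + z) = cpow y s * cpow y z.
Proof. by rewrite /cpow mulrDl cexpD. Qed.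

Lemma cpow_neq0 y s : cpow y s != 0.
Proof. exact: cexp_neq0. Qed.

Lemma cpowN y s : cpow y (- s) = (cpow y s)^-1.
Proof.
apply: (mulfI (cpow_neq0 y s)).
by rewrite -cpowD subrr cpow0 mulfV// cpow_neq0.
Qed.

Lemma cpowM x y s : 0 < x -> 0 < y -> cpow (x * y) s = cpow x s * cpow y s.
Proof. by move=> x0 y0; rewrite /cpow lnM// rmorphD mulrDr cexpD. Qed.

Lemma cpowV y s : 0 < y -> cpow y^-1 s = cpow y (- s).
Proof. by move=> y0; rewrite /cpow lnV// rmorphN mulrN mulNr. Qed.

Lemma gt0_powRE y r : 0 < y -> y `^ r = expR (r * ln y).
Proof. by move=> y0; rewrite /powR gt_eqF. Qed.

Lemma normc_cpow y s : 0 < y -> normc (cpow y s) = y `^ Re s.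
Proof. by move=> y0; rewrite normc_cexp ReM mulr0 subr0 gt0_powRE. Qed.

Lemma cpow_powR y r s : 0 < y -> cpow (y `^ r) s = cpow y (r%:C * s).
Proof. by move=> y0; rewrite /cpow ln_powR rmorphM mulrA (mulrC s). Qed.

Lemma cpowC y r : 0 < y -> cpow y r%:C = (y `^ r)%:C.
Proof.
move=> y0; rewrite /cpow /cexp -rmorphM/= cos0 sin0 gt0_powRE//.
by apply: complexP; rewrite !(ReM, ImM)/=; ring.
Qed.

Lemma cpow_natr y n : 0 < y -> cpow y n%:R = (y ^+ n)%:C.
Proof. by move=> y0; rewrite natrC cpowC// powR_mulrn// ltW. Qed.

Lemma Re_cpow y s : 0 < y -> Re (cpow y s) = y `^ Re s * cos (Im s * ln y).
Proof.
move=> y0; rewrite /cpow /cexp ReMC ReM ImM/=.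
by rewrite !mulr0 subr0 add0r gt0_powRE.
Qed.

Lemma Im_cpow y s : 0 < y -> Im (cpow y s) = y `^ Re s * sin (Im s * ln y).
Proof.
move=> y0; rewrite /cpow /cexp ImMC ReM ImM/=.
by rewrite !mulr0 subr0 add0r gt0_powRE.
Qed.

End ComplexPowers.

#[local] Arguments cpow : simpl never.
#[local] Arguments normc : simpl never.

(** * Integration of complex-valued functions *)

Section ComplexMeasurability.
Context d (T : measurableType d) (R : realType) (D : set T).
Implicit Types f g : T -> R[i].

Definition cmeasurable f : Prop :=
  measurable_fun D (fun t => Re (f t)) /\ measurable_fun D (fun t => Im (f t)).

Lemma cmeasurable_cst (z : R[i]) : cmeasurable (fun=> z).
Proof. by split; exact: measurable_cst. Qed.

Lemma cmeasurable_real (h : T -> R) :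
  measurable_fun D h -> cmeasurable (fun t => (h t)%:C).
Proof. by move=> mh; split => //; exact: measurable_cst. Qed.

Lemma cmeasurableM f g : cmeasurable f -> cmeasurable g ->
  cmeasurable (fun t => f t * g t).
Proof.
move=> [f1 f2] [g1 g2]; split.
- under eq_fun do rewrite ReM.
  by apply: measurable_funB; exact: measurable_funM.
- under eq_fun do rewrite ImM.
  by apply: measurable_funD; exact: measurable_funM.
Qed.

Lemma cmeasurable_sum (f : nat -> T -> R[i]) n :
  (forall i, cmeasurable (f i)) -> cmeasurable (fun t => \sum_(0 <= i < n) f i t).
Proof.
move=> mf; split.
- under eq_fun do rewrite Re_sum.
  by apply: measurable_sum => i; exact: (mf i).1.
- under eq_fun do rewrite Im_sum.
  by apply: measurable_sum => i; exact: (mf i).2.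
Qed.

Lemma cmeasurable_cpow (h : T -> R) (s : R[i]) :
  measurable_fun D h -> cmeasurable (fun t => cpow (h t) s).
Proof.
move=> mh.
have mln : measurable_fun D (fun t => ln (h t)).
  exact: (measurableT_comp (@measurable_ln R)).
have [mRe mIm] : cmeasurable (fun t => s * (ln (h t))%:C).
  by apply: cmeasurableM; [exact: cmeasurable_cst|exact: cmeasurable_real].
apply: cmeasurableM.
  by apply: cmeasurable_real; exact: (measurableT_comp (@measurable_expR R)).
split => /=.
- apply: (measurableT_comp _ mIm); apply: continuous_measurable_fun.
  exact: continuous_cos.
- apply: (measurableT_comp _ mIm); apply: continuous_measurable_fun.
  exact: continuous_sin.
Qed.

Lemma measurable_normc f : cmeasurable f -> measurable_fun D (fun t => normc (f t)).
Proof.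
move=> [mRe mIm].
have -> : (fun t => normc (f t)) =
    (fun t => Num.sqrt (Re (f t) ^+ 2 + Im (f t) ^+ 2)).
  by apply/funext => t; rewrite /normc; case: (f t).
apply: (measurableT_comp (f := @Num.sqrt R)).
  by apply: continuous_measurable_fun; exact: sqrt_continuous.
by apply: measurable_funD; exact: measurable_funX.
Qed.

End ComplexMeasurability.

Lemma cmeasurable_funTS d (T : measurableType d) (R : realType) (D : set T)
  (f : T -> R[i]) : cmeasurable setT f -> cmeasurable D f.
Proof. by move=> [? ?]; split; exact: measurable_funTS. Qed.

Lemma cmeasurable_if d (T : measurableType d) (R : realType) (b : T -> bool)
    (f : T -> R[i]) : measurable_fun setT b -> cmeasurable setT f ->
  cmeasurable setT (fun t => if b t then f t else 0).
Proof.
move=> mb [mRe mIm]; split; under eq_fun do rewrite fun_if.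
- by apply: measurable_fun_ifT => //; exact: measurable_cst.
- by apply: measurable_fun_ifT => //; exact: measurable_cst.
Qed.

Section ComplexIntegral.
Variable R : realType.
Local Notation mu := (@lebesgue_measure R).
Implicit Types (D : set R) (f : R -> R[i]) (h : R -> R).

Lemma cintegrable_measurable D f : cintegrable D f -> cmeasurable D f.
Proof.
by move=> [/measurable_int/measurable_EFinP ? /measurable_int/measurable_EFinP ?].
Qed.

Lemma cintegrable_le D f h : measurable D -> cmeasurable D f ->
  mu.-integrable D (EFin \o h) -> (forall t, D t -> normc (f t) <= h t) ->
  cintegrable D f.
Proof.
move=> mD [mRe mIm] ih fh.
have aux (u : R -> R) : measurable_fun D u -> (forall t, `|u t| <= normc (f t)) ->
    mu.-integrable D (fun t => (u t)%:E).
  move=> mu_ uf; apply: (@le_integrable _ _ _ mu D mD _ (EFin \o h)) => [|t Dt|//]; first exact/measurable_EFinP.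
  rewrite /= lee_fin (le_trans (uf t))// (le_trans (fh t Dt))//.
  exact: ler_norm.
by split; apply: aux => // t; [exact: normc_Re|exact: normc_Im].
Qed.

Lemma cintegrable_normc D f : measurable D -> cintegrable D f ->
  mu.-integrable D (fun t => (normc (f t))%:E).
Proof.
move=> mD [iRe iIm].
have mf := cintegrable_measurable (conj iRe iIm).
apply: (@le_integrable _ _ _ mu D mD _
    (fun t => `|(Re (f t))%:E| + `|(Im (f t))%:E|)%E).
- exact/measurable_EFinP/measurable_normc.
- move=> t _ /=; rewrite lee_fin ger0_norm ?normc_ge0//.
  by rewrite (le_trans (normc_le_ReIm _))// ler_norm.
- by apply: integrableD => //; exact: integrable_abse.
Qed.

(** Most integrability proofs below end here: the modulus of a complex power
    of t is a real power of t, whose integral is computed by the real version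
    of the same formula. *)
Lemma normc_fin_cintegrable D f : measurable D -> cmeasurable D f ->
  (\int[mu]_(t in D) (normc (f t))%:E < +oo)%E -> cintegrable D f.
Proof.
move=> mD mf foo; apply: (@cintegrable_le _ _ (fun t => normc (f t))) => //.
apply/integrableP; split; first exact/measurable_EFinP/measurable_normc.
by under eq_integral do rewrite /= ger0_norm ?normc_ge0//.
Qed.

Lemma eq_cintegral D f g : (forall t, D t -> f t = g t) ->
  cintegral D f = cintegral D g.
Proof.
move=> fg; rewrite /cintegral; congr (_ +i* _);
  by apply: eq_Rintegral => t /[!inE] Dt; rewrite fg.
Qed.

Lemma eq_cintegrable D f g : measurable D -> (forall t, D t -> f t = g t) ->
  cintegrable D f -> cintegrable D g.
Proof.
move=> mD fg [fRe fIm]; split.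
- by apply: eq_integrable fRe => // t /[!inE] Dt; rewrite fg.
- by apply: eq_integrable fIm => // t /[!inE] Dt; rewrite fg.
Qed.

Lemma cintegrableZl D f (a : R[i]) : measurable D ->
  cintegrable D f -> cintegrable D (fun t => a * f t).
Proof.
move=> mD fD; have ifD := cintegrable_normc mD fD.
apply: (@cintegrable_le _ _ (fun t => normc a * normc (f t))) => //.
- apply: cmeasurableM; [exact: cmeasurable_cst|exact: cintegrable_measurable].
- under [X in integrable _ _ X]funext do rewrite /= EFinM.
  exact: integrableZl.
- by move=> t _; rewrite normcM.
Qed.

Lemma cintegralZl D f (a : R[i]) : measurable D -> cintegrable D f ->
  cintegral D (fun t => a * f t) = a * cintegral D f.
Proof.
move=> mD [fRe fIm]; apply: complexP => /=.
- rewrite ReM/= -!RintegralZl// -RintegralB//; last 2 first.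
  + by under [X in integrable _ _ X]funext do rewrite /= EFinM; exact: integrableZl.
  + by under [X in integrable _ _ X]funext do rewrite /= EFinM; exact: integrableZl.
  by apply: eq_Rintegral => t _; rewrite ReM.
- rewrite ImM/= -!RintegralZl// -RintegralD//; last 2 first.
  + by under [X in integrable _ _ X]funext do rewrite /= EFinM; exact: integrableZl.
  + by under [X in integrable _ _ X]funext do rewrite /= EFinM; exact: integrableZl.
  by apply: eq_Rintegral => t _; rewrite ImM.
Qed.

Lemma cintegral_sum D (f : nat -> R -> R[i]) n : measurable D ->
  (forall i, cintegrable D (f i)) ->
  cintegral D (fun t => \sum_(0 <= i < n) f i t) =
  \sum_(0 <= i < n) cintegral D (f i).
Proof.
move=> mD fi; apply: complexP.
- rewrite Re_sum/= /Rintegral.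
  under eq_integral do rewrite Re_sum -sumEFin.
  rewrite integral_sum//; last by move=> i; exact: (fi i).1.
  rewrite [RHS](eq_bigr (fun i => fine (\int[mu]_(x in D) (Re (f i x))%:E)%E))//.
  rewrite sum_fine// => i _; apply: integrable_fin_num => //; exact: (fi i).1.
- rewrite Im_sum/= /Rintegral.
  under eq_integral do rewrite Im_sum -sumEFin.
  rewrite integral_sum//; last by move=> i; exact: (fi i).2.
  rewrite [RHS](eq_bigr (fun i => fine (\int[mu]_(x in D) (Im (f i x))%:E)%E))//.
  rewrite sum_fine// => i _; apply: integrable_fin_num => //; exact: (fi i).2.
Qed.

End ComplexIntegral.

(** * Fubini and dominated convergence *)

Section Fubini.
Variable R : realType.
Local Notation mu := (@lebesgue_measure R).
Variables (D1 D2 : set R) (mD1 : measurable D1) (mD2 : measurable D2).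

(* Iterated integrals over D1 and D2 are turned into integrals over the whole
   spaces of the extension by 0 outside D1 x D2. *)
Let patch12 (f : R * R -> \bar R) :
  (\int[mu]_(x in D1) \int[mu]_(y in D2) f (x, y) =
   \int[mu]_x \int[mu]_y (f \_ (D1 `*` D2)) (x, y))%E.
Proof.
rewrite integral_mkcond; apply: eq_integral => x _.
rewrite patchE; case: ifPn => xD; last first.
  rewrite integral0_eq// => y _; rewrite patchE ifF//.
  by apply: contraNF xD; rewrite !inE => -[].
rewrite integral_mkcond; apply: eq_integral => y _; rewrite !patchE.
congr (if _ then _ else _); apply/idP/idP; rewrite !inE => h.
- by split => //; rewrite inE in xD.
- by case: h.
Qed.

Let patch21 (f : R * R -> \bar R) :
  (\int[mu]_(y in D2) \int[mu]_(x in D1) f (x, y) =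
   \int[mu]_y \int[mu]_x (f \_ (D1 `*` D2)) (x, y))%E.
Proof.
rewrite integral_mkcond; apply: eq_integral => y _.
rewrite patchE; case: ifPn => yD; last first.
  rewrite integral0_eq// => x _; rewrite patchE ifF//.
  by apply: contraNF yD; rewrite !inE => -[].
rewrite integral_mkcond; apply: eq_integral => x _; rewrite !patchE.
congr (if _ then _ else _); apply/idP/idP; rewrite !inE => h.
- by split => //; rewrite inE in yD.
- by case: h.
Qed.

Let mpatch (f : R * R -> \bar R) : measurable_fun setT f ->
  measurable_fun setT (f \_ (D1 `*` D2)).
Proof.
move=> mf; apply: (measurable_restrictT f (measurableX mD1 mD2)).1.
exact: measurable_funTS.
Qed.

Lemma tonelli_on (f : R * R -> R) : measurable_fun setT f ->
  (forall x y, D1 x -> D2 y -> 0 <= f (x, y)) ->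
  (\int[mu]_(x in D1) \int[mu]_(y in D2) (f (x, y))%:E =
   \int[mu]_(y in D2) \int[mu]_(x in D1) (f (x, y))%:E)%E.
Proof.
move=> mf f0; rewrite (patch12 (EFin \o f)) (patch21 (EFin \o f)).
apply: (@fubini_tonelli _ _ _ _ R mu mu ((EFin \o f) \_ (D1 `*` D2))).
  by apply: mpatch; exact/measurable_EFinP.
move=> [x y]; rewrite patchE; case: ifPn => //.
by rewrite inE => -[/= ? ?]; rewrite lee_fin f0.
Qed.

(** The inner real integrals are finite for almost every value of the outer
    variable only; [fine] alters the inner integral on a null set. *)
Lemma Rfubini_on (f : R * R -> R) : measurable_fun setT f ->
  (\int[mu]_(x in D1) \int[mu]_(y in D2) `|(f (x, y))%:E| < +oo)%E ->
  \int[mu]_(x in D1) \int[mu]_(y in D2) f (x, y) =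
  \int[mu]_(y in D2) \int[mu]_(x in D1) f (x, y).
Proof.
move=> mf foo.
pose g := (EFin \o f) \_ (D1 `*` D2).
have mg : measurable_fun setT g by apply: mpatch; exact/measurable_EFinP.
have ig : (mu \x mu)%E.-integrable setT g.
  apply: (@integrable12ltyP _ _ _ _ R mu mu g mg).2; move: foo.
  rewrite (patch12 (fun p => `|(f p)%:E|)%E) => /le_lt_trans; apply.
  rewrite le_eqVlt; apply/orP; left; apply/eqP.
  apply: eq_integral => x _; apply: eq_integral => y _.
  by rewrite /g !patchE; case: ifPn => // _; rewrite abse0.
have restrict1 x : D1 x -> (fun y => g (x, y)) = (fun y => (f (x, y))%:E) \_ D2.
  move=> D1x; apply/funext => y; rewrite /g !patchE.
  congr (if _ then _ else _); apply/idP/idP; rewrite !inE; [by case|by split].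
have restrict2 y : D2 y -> (fun x => g (x, y)) = (fun x => (f (x, y))%:E) \_ D1.
  move=> D2y; apply/funext => x; rewrite /g !patchE.
  congr (if _ then _ else _); apply/idP/idP; rewrite !inE; [by case|by split].
have mI1 : measurable_fun setT (fun x => \int[mu]_y g (x, y))%E.
  exact: measurable_fubini_F ig.
have mI2 : measurable_fun setT (fun y => \int[mu]_x g (x, y))%E.
  exact: measurable_fubini_G ig.
rewrite /Rintegral; congr fine.
transitivity (\int[mu]_x \int[mu]_y g (x, y))%E.
  transitivity (\int[mu]_(x in D1) \int[mu]_y g (x, y))%E; last first.
    rewrite integral_mkcond; apply: eq_integral => x _; rewrite patchE.
    case: ifPn => // xD; rewrite integral0_eq// => y _.
    rewrite /g patchE ifF//; apply: contraNF xD.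
    by rewrite !inE => -[].
  under eq_integral => x /[!inE] D1x do rewrite integral_mkcond -restrict1//.
  apply: ae_eq_integral => //.
  - apply/measurable_EFinP; apply: (measurableT_comp (@fine_measurable R setT _)) => //.
    exact: measurable_funTS.
  - exact: measurable_funTS.
  - have := ae_integrable1 ig; apply: filterS => x ix D1x /=.
    by rewrite fineK//; exact: integrable_fin_num.
rewrite (Fubini ig); apply/esym.
transitivity (\int[mu]_(y in D2) \int[mu]_x g (x, y))%E; last first.
  rewrite integral_mkcond; apply: eq_integral => y _; rewrite patchE.
  case: ifPn => // yD; rewrite integral0_eq// => x _.
  rewrite /g patchE ifF//; apply: contraNF yD.
  by rewrite !inE => -[].
under eq_integral => y /[!inE] D2y do rewrite integral_mkcond -restrict2//.
apply: ae_eq_integral => //.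
- apply/measurable_EFinP; apply: (measurableT_comp (@fine_measurable R setT _)) => //.
  exact: measurable_funTS.
- exact: measurable_funTS.
- have := ae_integrable2 ig; apply: filterS => y iy D2y /=.
  by rewrite fineK//; exact: integrable_fin_num.
Qed.

Lemma cfubini_on (f : R * R -> R[i]) : cmeasurable setT f ->
  (\int[mu]_(x in D1) \int[mu]_(y in D2) (normc (f (x, y)))%:E < +oo)%E ->
  cintegral D1 (fun x => cintegral D2 (fun y => f (x, y))) =
  cintegral D2 (fun y => cintegral D1 (fun x => f (x, y))).
Proof.
move=> mf foo.
have mnf := measurable_normc mf.
have bound (u : R * R -> R) : measurable_fun setT u ->
    (forall p, `|u p| <= normc (f p)) ->
    (\int[mu]_(x in D1) \int[mu]_(y in D2) `|(u (x, y))%:E| < +oo)%E.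
  move=> mu_ uf; apply: le_lt_trans foo.
  rewrite (patch12 (fun p => `|(u p)%:E|)%E) (patch12 (fun p => (normc (f p))%:E)).
  have mp1 : measurable_fun setT ((fun p => `|(u p)%:E|)%E \_ (D1 `*` D2)).
    by apply: mpatch; apply/measurable_EFinP; exact: measurableT_comp.
  have mp2 : measurable_fun setT ((fun p => (normc (f p))%:E)%E \_ (D1 `*` D2)).
    by apply: mpatch; exact/measurable_EFinP.
  have p1_ge0 p : (0 <= ((fun p => `|(u p)%:E|)%E \_ (D1 `*` D2)) p)%E.
    by rewrite patchE; case: ifPn.
  have p2_ge0 p : (0 <= ((fun p => (normc (f p))%:E)%E \_ (D1 `*` D2)) p)%E.
    by rewrite patchE; case: ifPn => // _; rewrite lee_fin normc_ge0.
  apply: ge0_le_integral => //.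
  - by move=> x _; exact: integral_ge0.
  - exact: (@measurable_fun_fubini_tonelli_F _ _ _ _ R mu _ mp1 p1_ge0).
  - exact: (@measurable_fun_fubini_tonelli_F _ _ _ _ R mu _ mp2 p2_ge0).
  - move=> x _; apply: ge0_le_integral => //.
    + exact: measurableT_comp mp1 (pair1_measurable x).
    + exact: measurableT_comp mp2 (pair1_measurable x).
    + move=> y _; rewrite !patchE; case: ifPn => // _.
      by rewrite lee_fin uf.
apply: complexP => /=.
- apply: (@Rfubini_on (fun p => Re (f p))); first exact: mf.1.
  by apply: (bound (fun p => Re (f p))); [exact: mf.1|move=> p; exact: normc_Re].
- apply: (@Rfubini_on (fun p => Im (f p))); first exact: mf.2.
  by apply: (bound (fun p => Im (f p))); [exact: mf.2|move=> p; exact: normc_Im].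
Qed.

End Fubini.

Section ComplexLimits.
Variable R : realType.
Local Notation mu := (@lebesgue_measure R).

(** The componentwise convergence under which [csum] is the sum of a series. *)
Definition ccvg (u : nat -> R[i]) (l : R[i]) : Prop :=
  ((fun n => Re (u n)) @ \oo --> Re l) /\ ((fun n => Im (u n)) @ \oo --> Im l).

Lemma ccvgZl (u : nat -> R[i]) (l a : R[i]) :
  ccvg u l -> ccvg (fun n => a * u n) (a * l).
Proof.
move=> [cRe cIm]; split.
- under eq_fun do rewrite ReM; rewrite ReM.
  by apply: cvgB; exact: cvgMl_tmp.
- under eq_fun do rewrite ImM; rewrite ImM.
  by apply: cvgD; exact: cvgMl_tmp.
Qed.

Lemma ccvg_unique (u : nat -> R[i]) (l l' : R[i]) :
  ccvg u l -> ccvg u l' -> l = l'.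
Proof.
move=> [uRe uIm] [uRe' uIm']; apply: complexP.
- exact: (cvg_unique _ uRe uRe').
- exact: (cvg_unique _ uIm uIm').
Qed.

(** Term-by-term integration shows that the hypergeometric partial sums converge
    and gives their limit, which is then the value of [csum]. *)
Lemma csumE (u : nat -> R[i]) (l : R[i]) :
  ccvg (fun N => \sum_(0 <= n < N) u n) l -> csum u = l.
Proof.
move=> [cRe cIm]; apply: complexP => /=; apply: cvg_lim => //.
- by move: cRe; under eq_fun do rewrite Re_sum.
- by move: cIm; under eq_fun do rewrite Im_sum.
Qed.

Lemma ccvg_csum (u : nat -> R[i]) :
  cvgn (series (fun n => normc (u n))) ->
  ccvg (fun N => \sum_(0 <= n < N) u n) (csum u).
Proof.
move=> cu; split => /=.
- under eq_fun do rewrite Re_sum.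
  have /normed_cvg : cvgn [normed series (fun n => Re (u n))].
    by apply: series_le_cvg cu => n /=; rewrite ?normc_ge0 ?normc_Re.
  exact.
- under eq_fun do rewrite Im_sum.
  have /normed_cvg : cvgn [normed series (fun n => Im (u n))].
    by apply: series_le_cvg cu => n /=; rewrite ?normc_ge0 ?normc_Im.
  exact.
Qed.

Lemma Rdominated_convergence (D : set R) (F : nat -> R -> R) (f h : R -> R) :
  measurable D -> (forall n, measurable_fun D (F n)) ->
  (forall t, D t -> (fun n => F n t) @ \oo --> f t) ->
  mu.-integrable D (EFin \o h) -> (forall n t, D t -> `|F n t| <= h t) ->
  mu.-integrable D (EFin \o f) /\
  ((fun n => \int[mu]_(t in D) F n t) @ \oo --> \int[mu]_(t in D) f t).
Proof.
move=> mD mF Ff ih Fh.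
have mf : measurable_fun D f by apply: (measurable_fun_cvg mF).
have [] := @dominated_convergence _ _ _ mu D mD
  (fun n t => (F n t)%:E) (EFin \o f) (EFin \o h).
- by move=> n; apply/measurable_EFinP; exact: mF.
- exact/measurable_EFinP.
- by apply: nearW => t Dt; apply: cvg_EFin; [exact: nearW|exact: Ff].
- exact: ih.
- by apply: nearW => t n Dt; rewrite lee_fin Fh.
move=> if_ _ cvgF; split => //; apply: fine_cvg.
by rewrite fineK//; exact: integrable_fin_num.
Qed.

Lemma cdominated_convergence (D : set R) (F : nat -> R -> R[i]) (f : R -> R[i])
    (h : R -> R) :
  measurable D -> (forall n, cmeasurable D (F n)) ->
  (forall t, D t -> ccvg (fun n => F n t) (f t)) ->
  mu.-integrable D (EFin \o h) -> (forall n t, D t -> normc (F n t) <= h t) ->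
  cintegrable D f /\ ccvg (fun n => cintegral D (F n)) (cintegral D f).
Proof.
move=> mD mF Ff ih Fh.
have [iRe cRe] := @Rdominated_convergence D (fun n t => Re (F n t))
  (fun t => Re (f t)) h mD (fun n => (mF n).1) (fun t Dt => (Ff t Dt).1) ih
  (fun n t Dt => le_trans (normc_Re _) (Fh n t Dt)).
have [iIm cIm] := @Rdominated_convergence D (fun n t => Im (F n t))
  (fun t => Im (f t)) h mD (fun n => (mF n).2) (fun t Dt => (Ff t Dt).2) ih
  (fun n t Dt => le_trans (normc_Im _) (Fh n t Dt)).
by [].
Qed.

End ComplexLimits.

(** * Integrals of power functions *)

Section ImproperFTC.
Variable R : realType.
Local Notation mu := (@lebesgue_measure R).
Variables (f F : R -> R) (x c : R).
Hypotheses (xc : x < c) (dF : forall t, x < t -> is_derive t 1 F (f t)).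
Hypothesis (cf : forall t, x < t -> {for t, continuous f}).
Hypothesis (F0 : F t @[t --> x^'+] --> 0).

Let e n : R := x + (c - x) / n.+2%:R.

Let xe n : x < e n.
Proof. by rewrite ltrDl divr_gt0// subr_gt0. Qed.

Let ec n : e n < c.
Proof.
rewrite -ltrBrDl ltr_pdivrMr// -[X in X < _]mulr1 ltr_pM2l ?subr_gt0//.
by rewrite ltr1n.
Qed.

Let e_cvg : e @ \oo --> x.
Proof.
rewrite -[X in _ --> X]addr0; apply: cvgD; first exact: cvg_cst.
rewrite -(mulr0 (c - x)); apply: cvgMl_tmp.
have := @cvg_harmonic R; rewrite -(cvg_shiftS (@harmonic R)); exact.
Qed.

Let Fe : (fun n => F c - F (e n)) @ \oo --> F c.
Proof.
rewrite -[X in _ --> X]subr0; apply: cvgB; first exact: cvg_cst.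
by apply: (cvg_at_rightP _ _ _).1 F0 _ _.
Qed.

Let FTCe n : (\int[mu]_(t in `[e n, c]) (f t)%:E = (F c - F (e n))%:E)%E.
Proof.
have cF t : x < t -> {for t, continuous F}.
  move=> /dF dFt; apply: differentiable_continuous.
  by apply/derivable1_diffP; exact: ex_derive.
rewrite EFinB; apply: continuous_FTC2 => //.
- apply: continuous_in_subspaceT => t; rewrite inE/= in_itv/= => /andP[et _].
  by apply: cf; exact: lt_le_trans et.
- split.
  + move=> t; rewrite in_itv/= => /andP[et _].
    by have /dF dFt := lt_trans (xe n) et; exact: ex_derive.
  + by apply: cvg_at_right_filter; apply: cF.
  + by apply: cvg_at_left_filter; apply: cF.
- move=> t; rewrite in_itv/= => /andP[et _].
  have /dF ? := lt_trans (xe n) et.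
  by rewrite derive1E; exact: derive_val.
Qed.

Let mf : measurable_fun `]x, c] f.
Proof.
apply: (@measurable_funS _ _ _ _ `]x, +oo[) => //.
- by move=> t /=; rewrite !in_itv/= andbT => /andP[].
- apply: open_continuous_measurable_fun => //.
  by move=> t; rewrite inE/= in_itv/= andbT => /cf.
Qed.

Let e_near t : x < t -> \forall n \near \oo, e n <= t.
Proof. by move=> xt; apply: cvgr_le e_cvg _ xt. Qed.

(** The integrand may be unbounded at x: the formula on [e n, c] passes to the
    limit by monotone convergence. *)
Lemma ge0_improper_FTC : (forall t, x < t -> 0 <= f t) ->
  (\int[mu]_(t in `]x, c]) (f t)%:E = (F c)%:E)%E.
Proof.
move=> f0.
have -> : `]x, c]%classic = \bigcup_n `[e n, c]%classic.
  apply/seteqP; split=> [t /=|t [n _ /=]]; rewrite !in_itv/=.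
  - move=> /andP[xt tc]; have [n _ /(_ n (leqnn n)) en] := e_near xt.
    by exists n => //=; rewrite in_itv/= en.
  - by move=> /andP[et ->]; rewrite (lt_le_trans (xe n) et).
have nd : {homo (fun n => `[e n, c]%classic : set R) : n m / (n <= m)%N >-> (n <= m)%O}.
  move=> n m nm; apply/subsetPset => t /=; rewrite !in_itv/= => /andP[et ->].
  rewrite andbT (le_trans _ et)// lerD2l ler_wpM2l ?subr_ge0 ?(ltW xc)//.
  by rewrite lef_pV2 ?posrE// ler_nat.
have mfe n : measurable_fun `[e n, c] (EFin \o f).
  apply/measurable_EFinP; apply: measurable_funS mf => //.
  by move=> t /=; rewrite !in_itv/= => /andP[et ->]; rewrite (lt_le_trans (xe n) et).
have f0e n t : `[e n, c]%classic t -> (0 <= (EFin \o f) t)%E.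
  rewrite /= in_itv/= => /andP[et _].
  by rewrite lee_fin f0// (lt_le_trans (xe n) et).
have cvgI := @ge0_nondecreasing_set_cvg_integral _ _ R _ _ mu nd
  (fun=> measurable_itv _) mfe f0e.
apply/esym; apply: (cvg_unique _ _ cvgI) => //=.
under eq_fun do rewrite FTCe.
by apply: cvg_EFin; [exact: nearW|exact: Fe].
Qed.

(** For a function of arbitrary sign the same limit is taken by dominated
    convergence, once integrability is known. *)
Lemma improper_FTC : mu.-integrable `]x, c] (EFin \o f) ->
  \int[mu]_(t in `]x, c]) f t = F c.
Proof.
move=> intf.
have [] := @Rdominated_convergence R `]x, c]%classic
  (fun n => f \_ `[e n, c]) f (fun t => `|f t|).
- by [].
- move=> n; apply: (measurable_restrict f (measurable_itv _) (measurable_itv _)).1.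
  by apply: measurable_funS mf => //; exact: subIsetr.
- move=> t /=; rewrite in_itv/= => /andP[xt tc].
  apply: cvg_near_cst; have := e_near xt; apply: filterS => n en.
  by rewrite patchE ifT// inE/= in_itv/= en.
- exact: integrable_norm.
- move=> n t _; rewrite patchE; case: ifPn => // _.
  by rewrite normr0.
move=> _ cvgI; have eqI n : \int[mu]_(t in `]x, c]) (f \_ `[e n, c]) t = F c - F (e n).
  rewrite -Rintegral_mkcondr setIidr.
    by rewrite /Rintegral FTCe.
  move=> t /=; rewrite !in_itv/= => /andP[et ->].
  by rewrite (lt_le_trans (xe n) et).
apply/esym; apply: (cvg_unique _ _ cvgI) => //=.
by under eq_fun do rewrite eqI; exact: Fe.
Qed.

End ImproperFTC.

Section PowerIntegral.
Variable R : realType.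
Local Notation mu := (@lebesgue_measure R).

Lemma gt0_powRD (y a b : R) : 0 < y -> y `^ (a + b) = y `^ a * y `^ b.
Proof. by move=> y0; rewrite powRD// (gt_eqF y0)/= implybT. Qed.

Lemma gt0_powRB1 (y a : R) : 0 < y -> y `^ a = y `^ (a - 1) * y.
Proof.
by move=> y0; rewrite -{3}(powRr1 (ltW y0)) -gt0_powRD// subrK.
Qed.

(** The real part of (A - i B) t^(a + i b).  These functions contain both
    components of every complex multiple of a power and, up to the exponent, are
    stable under differentiation. *)
Let osc (a b A B t : R) : R := t `^ a * (A * cos (b * ln t) + B * sin (b * ln t)).

Let is_derive_osc (x a b A B t : R) : x < t ->
  is_derive t 1 (fun t => osc a b A B (t - x))
    (osc (a - 1) b (a * A + b * B) (a * B - b * A) (t - x)).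
Proof.
rewrite -subr_gt0 => tx0.
have dsh : is_derive t 1 (fun t : R => t - x) 1.
  by apply: is_derive_eq; rewrite subr0.
have dpow : is_derive t 1 (fun t => (t - x) `^ a) (a * (t - x) `^ (a - 1) * 1).
  exact: (is_derive1_comp (g := fun t => t - x) (is_derive1_powR a tx0) dsh).
have dln : is_derive t 1 (fun t => ln (t - x)) ((t - x)^-1 * 1).
  exact: (is_derive1_comp (g := fun t => t - x) (is_derive1_ln tx0) dsh).
have dbln : is_derive t 1 (fun t => b * ln (t - x)) (b * ((t - x)^-1 * 1)).
  exact: is_deriveZ.
pose th t := b * ln (t - x).
have dcos : is_derive t 1 (fun t => cos (th t)) (- sin (th t) * (b * ((t - x)^-1 * 1))).
  exact: (is_derive1_comp (g := th) (is_derive_cos (th t)) dbln).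
have dsin : is_derive t 1 (fun t => sin (th t)) (cos (th t) * (b * ((t - x)^-1 * 1))).
  exact: (is_derive1_comp (g := th) (is_derive_sin (th t)) dbln).
have dA := is_deriveZ A dcos.
have dB := is_deriveZ B dsin.
have dAB : is_derive t 1 (fun t => A * cos (th t) + B * sin (th t))
    (A * (- sin (th t) * (b * ((t - x)^-1 * 1))) +
     B * (cos (th t) * (b * ((t - x)^-1 * 1)))).
  exact: is_deriveD dA dB.
apply: (is_derive_eq (is_deriveM dpow dAB)).
rewrite /osc /= /GRing.scale/= -/(th t).
have -> : (t - x) `^ a = (t - x) `^ (a - 1) * (t - x).
  by rewrite gt0_powRB1.
field.
by rewrite gt_eqF.
Qed.

Let continuous_osc (x a b A B t : R) : x < t ->
  {for t, continuous (fun t => osc a b A B (t - x))}.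
Proof.
move=> xt; apply: differentiable_continuous; apply/derivable1_diffP.
have dF := is_derive_osc a b A B xt; exact: ex_derive.
Qed.

Lemma cvg_powR_shift (x a : R) : 0 < a -> (t - x) `^ a @[t --> x^'+] --> 0.
Proof.
move=> a0; apply/cvg_at_rightP => u [xu ux].
have /cvg_at_rightP := powR_cvg0 a0; apply; split.
  by move=> n; rewrite subr_gt0.
by rewrite -(subrr x); apply: cvgB => //; exact: cvg_cst.
Qed.

Let osc_cvg0 (x a b A B : R) : 0 < a ->
  osc a b A B (t - x) @[t --> x^'+] --> 0.
Proof.
move=> a0; apply: norm_cvg0.
apply: (@squeeze_cvgr _ _ _ R (fun=> 0) (fun t => (t - x) `^ a * (`|A| + `|B|))).
- apply: nearW => t; rewrite normr_ge0/= /osc normrM ger0_norm ?powR_ge0//.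
  rewrite ler_wpM2l ?powR_ge0// (le_trans (ler_normD _ _))// lerD// normrM.
  + by rewrite ler_piMr// ler_norml cos_geN1 cos_le1.
  + by rewrite ler_piMr// ler_norml sin_geN1 sin_le1.
- exact: cvg_cst.
- rewrite -(mul0r (`|A| + `|B|)); apply: cvgM; last exact: cvg_cst.
  exact: cvg_powR_shift.
Qed.

Lemma integral_powR (x c a : R) : 0 < a -> x < c ->
  (\int[mu]_(t in `]x, c]) ((t - x) `^ (a - 1))%:E = ((c - x) `^ a / a)%:E)%E.
Proof.
move=> a0 xc; have an0 : a != 0 by rewrite gt_eqF.
have oscE t : osc (a - 1) 0 (a * a^-1 + 0 * 0) (a * 0 - 0 * a^-1) (t - x) =
    (t - x) `^ (a - 1).
  by rewrite /osc !mul0r cos0 sin0 divff//; ring.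
under eq_integral do rewrite -oscE.
transitivity (osc a 0 a^-1 0 (c - x))%:E; last first.
  by rewrite /osc !mul0r cos0 mulr1 addr0.
apply: (ge0_improper_FTC (F := fun t => osc a 0 a^-1 0 (t - x))) => //.
- by move=> t; exact: is_derive_osc.
- by move=> t; exact: continuous_osc.
- exact: osc_cvg0.
- by move=> t _; rewrite oscE powR_ge0.
Qed.

Lemma cintegrable_cpow (x c : R) (z : R[i]) : 0 < Re z -> x < c ->
  cintegrable `]x, c] (fun t => cpow (t - x) (z - 1)).
Proof.
move=> z0 xc; apply: normc_fin_cintegrable => //.
  apply: cmeasurable_cpow; apply: measurable_funB => //; exact: measurable_cst.
rewrite [X in (X < _)%E](_ : _ =
    \int[mu]_(t in `]x, c]) ((t - x) `^ (Re z - 1))%:E)%E.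
  by rewrite integral_powR// ltry.
apply: eq_integral => t; rewrite inE/= in_itv/= => /andP[xt _].
by rewrite normc_cpow ?subr_gt0// ReD ReN.
Qed.

Lemma cintegral_cpow (x c : R) (z : R[i]) : 0 < Re z -> x < c ->
  cintegral `]x, c] (fun t => cpow (t - x) (z - 1)) = cpow (c - x) z / z.
Proof.
move=> z0 xc; have [iRe iIm] := cintegrable_cpow z0 xc.
have zn0 : z != 0 by apply: contraTneq z0 => ->; rewrite ltxx.
(* The components of t^z / z are osc functions whose coefficients are those of
   1 / z; the equations wRe and wIm say that z / z = 1. *)
pose w := z^-1; pose a := Re z; pose b := Im z.
have wRe : a * Re w - b * Im w = 1 by rewrite -ReM divff.
have wIm : a * Im w + b * Re w = 0 by rewrite -ImM divff.
have aE : Re (z - 1) = a - 1 by rewrite ReD ReN.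
have bE : Im (z - 1) = b by rewrite ImD ImN/= oppr0 addr0.
have itvP t : `]x, c]%classic t -> 0 < t - x.
  by rewrite /= in_itv/= subr_gt0 => /andP[].
apply: complexP; last first.
- transitivity (\int[mu]_(t in `]x, c])
      osc (a - 1) b (a * Im w + b * Re w) (a * Re w - b * Im w) (t - x)).
    apply: eq_Rintegral => t /[!inE] /itvP tx0; rewrite Im_cpow// aE bE /osc wIm wRe; ring.
  transitivity (osc a b (Im w) (Re w) (c - x)); last first.
    by rewrite ImM Re_cpow ?Im_cpow ?subr_gt0// -/a -/b -/w /osc; ring.
  apply: (improper_FTC (F := fun t => osc a b (Im w) (Re w) (t - x))) => //.
  + by move=> t; exact: is_derive_osc.
  + by move=> t; exact: continuous_osc.
  + exact: osc_cvg0.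
  + apply: eq_integrable iIm => // t /[!inE] /itvP tx0.
    by rewrite Im_cpow// aE bE /osc wIm wRe; congr EFin; ring.
- transitivity (\int[mu]_(t in `]x, c])
      osc (a - 1) b (a * Re w + b * - Im w) (a * - Im w - b * Re w) (t - x)).
    apply: eq_Rintegral => t /[!inE] /itvP tx0; rewrite Re_cpow// aE bE /osc.
    by rewrite !mulrN wRe -opprD wIm; ring.
  transitivity (osc a b (Re w) (- Im w) (c - x)); last first.
    by rewrite ReM Re_cpow ?Im_cpow ?subr_gt0// -/a -/b -/w /osc; ring.
  apply: (improper_FTC (F := fun t => osc a b (Re w) (- Im w) (t - x))) => //.
  + by move=> t; exact: is_derive_osc.
  + by move=> t; exact: continuous_osc.
  + exact: osc_cvg0.
  + apply: eq_integrable iRe => // t /[!inE] /itvP tx0.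
    rewrite Re_cpow// aE bE /osc !mulrN wRe -opprD wIm; congr EFin; ring.
Qed.

End PowerIntegral.

(** * Euler integrals *)

Section LayerCake.
Variable R : realType.
Local Notation mu := (@lebesgue_measure R).

Lemma integral_expRN (q : R) :
  (\int[mu]_(y in `[q, +oo[) (expR (- y))%:E = (expR (- q))%:E)%E.
Proof.
have dF (y : R) : is_derive y 1 (fun y : R => - expR (- y)) (expR (- y)).
  have dN : is_derive y 1 (fun y : R => - y) (-1) by apply: is_derive_eq.
  have dE := is_derive1_comp (g := fun y : R => - y) (is_derive_expR (- y)) dN.
  apply: is_derive_eq (is_deriveN dE) _.
  by rewrite mulrN1 opprK.
have cE : continuous (fun y : R => expR (- y)).
  move=> y; apply: continuous_comp; first exact: opp_continuous.
  exact: continuous_expR.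
rewrite (@ge0_continuous_FTC2y _ _ (fun y => - expR (- y)) q 0)//.
- by rewrite -EFinB sub0r opprK.
- exact: continuous_subspaceT.
- by rewrite -oppr0; apply: cvgN; exact: cvgr_expR.
- apply: cvg_at_right_filter; apply: cvgN; exact: cE.
- by move=> y _; rewrite derive1E (@derive_val _ _ _ _ _ _ _ (dF y)).
Qed.

(** This is ln u < u at u = y / (2 a). *)
Lemma powR_le_expR (a y : R) : 0 < a -> 0 < y ->
  y `^ a <= (2 * a) `^ a * expR (y / 2).
Proof.
move=> a0 y0; have aa0 : 0 < 2 * a by rewrite mulr_gt0.
rewrite !gt0_powRE// -expRD ler_expR.
have q0 : 0 < y / (2 * a) by rewrite divr_gt0.
have /ltW := ln_sublinear q0.
rewrite ln_div ?posrE// -(ler_pM2l a0) mulrBr lerBlDl.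
by rewrite (_ : a * (y / (2 * a)) = y / 2)//; field; rewrite gt_eqF.
Qed.

(** Half of the exponential decay absorbs the power, which leaves a multiple of
    the exponential density of rate 1 / 2. *)
Lemma integral_powR_expR_lty (a : R) : 0 < a ->
  (\int[mu]_(y in `]0%R, +oo[) (y `^ a * expR (- y))%:E < +oo)%E.
Proof.
move=> a0.
pose C := 2 * (2 * a) `^ a.
have mpdf : measurable_fun setT (fun y : R => (exponential_pdf 2^-1 y)%:E).
  by apply/measurable_EFinP; exact: measurable_exponential_pdf.
have pdf0 (y : R) : (0 <= (exponential_pdf 2^-1 y)%:E)%E.
  by rewrite lee_fin exponential_pdf_ge0.
have C0 : 0 <= C by rewrite mulr_ge0// powR_ge0.
have Cfin : (\int[mu]_(y in `]0%R, +oo[) (C%:E * (exponential_pdf 2^-1 y)%:E) < +oo)%E.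
  apply: le_lt_trans (ltry C).
  rewrite ge0_integralZl//; last exact: measurable_funTS.
  rewrite -[leRHS]mule1 lee_wpmul2l// -(@integral_exponential_pdf R 2^-1)//.
  exact: ge0_subset_integral.
apply: le_lt_trans Cfin; apply: ge0_le_integral => //.
- by move=> y _; rewrite lee_fin mulr_ge0 ?powR_ge0 ?expR_ge0.
- apply/measurable_EFinP; apply: measurable_funM.
    by apply: measurable_funTS; exact: measurable_powR.
  apply: measurableT_comp => //; exact: measurableT_comp.
- by apply/measurable_funTS; apply: emeasurable_funM => //; exact: measurable_cst.
- move=> y; rewrite /= in_itv/= andbT => y0.
  rewrite -EFinM lee_fin (exponential_pdfE _ (ltW y0)) /C.
  rewrite [leRHS](_ : _ = (2 * a) `^ a * expR (- 2^-1 * y)); last by field.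
  rewrite (_ : expR (- 2^-1 * y) = expR (y / 2) * expR (- y)); last first.
    by rewrite -expRD; congr expR; field.
  by rewrite mulrA ler_wpM2r ?expR_ge0// powR_le_expR.
Qed.

Lemma integral_if (D : set R) (b : pred R) (f : R -> R) :
  (\int[mu]_(t in D) (if b t then f t else 0)%:E =
   \int[mu]_(t in D `&` [set t | b t]) (f t)%:E)%E.
Proof.
rewrite integral_mkcondr; apply: eq_integral => t _.
rewrite patchE (_ : (t \in _) = b t); first by case: (b t).
by apply/idP/idP; rewrite inE.
Qed.

Lemma cintegral_if (D : set R) (b : pred R) (f : R -> R[i]) :
  cintegral D (fun t => if b t then f t else 0) =
  cintegral (D `&` [set t | b t]) f.
Proof.
apply: complexP; rewrite /= /Rintegral -integral_if; congr fine;
  by apply: eq_integral => t _; case: ifP.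
Qed.

Lemma cintegralC (D : set R) (g : R -> R) :
  cintegral D (fun t => (g t)%:C) = (\int[mu]_(t in D) g t)%:C.
Proof.
by apply: complexP => //=; rewrite /Rintegral integral0.
Qed.

End LayerCake.

Section StretchedExponential.
Variable R : realType.
Local Notation mu := (@lebesgue_measure R).

Lemma cintegrable_cpow_expR (w : R[i]) : 0 < Re w ->
  cintegrable `]0, +oo[ (fun y => cpow y w * (expR (- y))%:C).
Proof.
move=> w0; apply: normc_fin_cintegrable => //.
  apply: cmeasurableM; first exact: cmeasurable_cpow.
  by apply/cmeasurable_real/measurable_funTS; exact: measurableT_comp.
apply: le_lt_trans (integral_powR_expR_lty w0).
rewrite le_eqVlt; apply/orP; left; apply/eqP; apply: eq_integral => y.
rewrite inE/= in_itv/= andbT => y0.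
by rewrite normcM normc_cpow// normcC ger0_norm ?expR_ge0.
Qed.

Variables (x p k : R) (p0 : 0 < p) (k0 : 0 < k).

Let q (t : R) := p * (t - x) `^ k.
(** Integrating [g (t, _)] gives exp (- q t); integrating over t first instead
    meets only the bounded interval where q t <= y. *)
Let g (u : R * R) : R := if q u.1 <= u.2 then expR (- u.2) else 0.

Let q_gt0 t : x < t -> 0 < q t.
Proof. by move=> xt; rewrite mulr_gt0// powR_gt0// subr_gt0. Qed.

Let g_ge0 u : 0 <= g u.
Proof. by rewrite /g; case: ifP => // _; exact: expR_ge0. Qed.

Let mq : measurable_fun setT q.
Proof.
apply: measurable_funM; first exact: measurable_cst.
apply: (measurableT_comp (measurable_powR k)).
by apply: measurable_funB => //; exact: measurable_cst.
Qed.

Let mg : measurable_fun setT g.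
Proof.
apply: measurable_fun_ifT.
- apply: measurable_fun_ler; last exact: measurable_snd.
  exact: measurableT_comp mq measurable_fst.
- by apply: measurableT_comp => //; apply: measurableT_comp => //; exact: measurable_snd.
- exact: measurable_cst.
Qed.

Let superlevel t : x < t ->
  `]0, +oo[ `&` [set y | q t <= y] = `[q t, +oo[%classic.
Proof.
move=> xt; apply/seteqP; split => y /=; rewrite !in_itv/= !andbT.
- by case.
- by move=> qy; split => //; exact: lt_le_trans (q_gt0 xt) qy.
Qed.

Let r (y : R) := (y / p) `^ k^-1.

Let sublevel y : 0 < y ->
  `]x, +oo[ `&` [set t | q t <= y] = `]x, x + r y]%classic.
Proof.
move=> y0; have yp0 : 0 < y / p by rewrite divr_gt0.
have kn0 : k != 0 by rewrite gt_eqF.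
have rk : r y `^ k = y / p by rewrite -powRrM mulVf// powRr1// ltW.
apply/seteqP; split => t /=; rewrite !in_itv/= ?andbT.
- move=> [xt qty]; rewrite xt/= -lerBlDl leNgt; apply/negP => rt.
  have := gt0_ltr_powR k0 (x := r y) (y := t - x).
  rewrite !nnegrE powR_ge0 subr_ge0 (ltW xt) rk => /(_ isT isT rt).
  by rewrite ltr_pdivrMr// mulrC ltNge qty.
- move=> /andP[xt]; rewrite -lerBlDl => rt; split => //.
  have := ge0_ler_powR (ltW k0) (x := t - x) (y := r y).
  rewrite !nnegrE powR_ge0 subr_ge0 (ltW xt) rk => /(_ isT isT rt).
  by rewrite ler_pdivlMr// mulrC.
Qed.

Let r_gt0 y : 0 < y -> 0 < r y.
Proof. by move=> y0; rewrite powR_gt0// divr_gt0. Qed.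

Let Rintegral_g t : x < t -> \int[mu]_(y in `]0, +oo[) g (t, y) = expR (- q t).
Proof.
by move=> xt; rewrite /Rintegral integral_if superlevel// integral_expRN.
Qed.

Let integral_g (a : R) :
  (\int[mu]_(t in `]x, +oo[) \int[mu]_(y in `]0%R, +oo[)
     ((t - x) `^ (a - 1) * g (t, y))%:E =
   \int[mu]_(t in `]x, +oo[) ((t - x) `^ (a - 1) * expR (- (p * (t - x) `^ k)))%:E)%E.
Proof.
apply: eq_integral => t /[!inE]/=; rewrite in_itv/= andbT => xt.
under eq_integral do rewrite EFinM.
rewrite ge0_integralZl_EFin ?powR_ge0//; last 2 first.
- by move=> y _; rewrite lee_fin.
- apply/measurable_funTS/measurable_EFinP.
  exact: measurableT_comp mg (pair1_measurable t).
by rewrite integral_if superlevel// integral_expRN.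
Qed.

(** The real counterpart of [cintegral_stretched], which bounds the modulus in
    the complex case. *)
Lemma integral_powR_stretched (a : R) : 0 < a ->
  (\int[mu]_(t in `]x, +oo[) ((t - x) `^ (a - 1) * expR (- (p * (t - x) `^ k)))%:E =
   (p `^ (- (a / k)) / a)%:E * \int[mu]_(y in `]0%R, +oo[) (y `^ (a / k) * expR (- y))%:E)%E.
Proof.
move=> a0.
have mpow : measurable_fun setT (fun t : R => (t - x) `^ (a - 1)).
  apply: (measurableT_comp (measurable_powR (a - 1))).
  by apply: measurable_funB => //; exact: measurable_cst.
rewrite -integral_g.
rewrite (@tonelli_on _ _ _ _ _ (fun u => (u.1 - x) `^ (a - 1) * g u))//; last 2 first.
- apply: measurable_funM => //.
  exact: measurableT_comp mpow measurable_fst.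
- by move=> t y _ _; rewrite mulr_ge0 ?powR_ge0.
rewrite -ge0_integralZl_EFin//; last 3 first.
- by move=> y _; rewrite lee_fin mulr_ge0 ?powR_ge0 ?expR_ge0.
- apply/measurable_funTS/measurable_EFinP/measurable_funM.
    exact: measurable_powR.
  by apply: measurableT_comp => //; exact: measurableT_comp.
- by rewrite divr_ge0 ?powR_ge0 ?ltW.
apply: eq_integral => y /[!inE]/=; rewrite in_itv/= andbT => y0.
transitivity (\int[mu]_(t in `]x, +oo[)
   ((expR (- y))%:E * (if (q t <= y)%R then (t - x) `^ (a - 1) else 0)%:E))%E.
  apply: eq_integral => t _; rewrite /g/= -EFinM; case: ifP => _.
  - by rewrite mulrC.
  - by rewrite !mulr0.
rewrite ge0_integralZl_EFin ?expR_ge0//; last 2 first.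
- by move=> t _; rewrite lee_fin; case: ifP => // _; exact: powR_ge0.
- apply/measurable_funTS/measurable_EFinP; apply: measurable_fun_ifT => //.
  by apply: measurable_fun_ler => //; exact: measurable_cst.
rewrite integral_if sublevel// integral_powR//; last by rewrite ltrDl r_gt0.
rewrite -!EFinM; congr EFin; rewrite addrAC subrr add0r /r -powRrM.
rewrite (mulrC k^-1) (powRM _ (ltW y0)) ?invr_ge0 ?(ltW p0)//.
rewrite -(powR_inv1 (ltW p0)) -powRrM mulN1r.
field; by rewrite gt_eqF.
Qed.

Lemma cintegrable_stretched (z : R[i]) : 0 < Re z ->
  cintegrable `]x, +oo[
    (fun t => cpow (t - x) (z - 1) * (expR (- (p * (t - x) `^ k)))%:C).
Proof.
move=> z0; apply: normc_fin_cintegrable => //.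
  apply: cmeasurableM.
    apply: cmeasurable_cpow; apply: measurable_funB => //; exact: measurable_cst.
  apply/cmeasurable_real/measurable_funTS.
  by apply: measurableT_comp => //; exact: measurableT_comp.
have fin := integral_powR_expR_lty (divr_gt0 z0 k0).
have ->/= : (\int[mu]_(t in `]x, +oo[)
    (normc (cpow (t - x) (z - 1) * (expR (- (p * (t - x) `^ k)))%:C))%:E =
    \int[mu]_(t in `]x, +oo[) ((t - x) `^ (Re z - 1) * expR (- (p * (t - x) `^ k)))%:E)%E.
  apply: eq_integral => t /[!inE]; rewrite /= in_itv andbT => /= xt.
  by rewrite normcM normc_cpow ?subr_gt0// normcC ger0_norm ?expR_ge0// ReD ReN.
rewrite integral_powR_stretched// lte_mul_pinfty// ?lee_fin.
by rewrite divr_ge0 ?powR_ge0 ?ltW.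
Qed.

(** The layer-cake formula: writing exp (- q) as the integral of exp (- y) over
    y >= q and exchanging the integrals leaves, for each y, the integral of a
    power over an interval of length (y / p)^(1 / k). *)
Lemma cintegral_stretched (z : R[i]) : 0 < Re z ->
  cintegral `]x, +oo[
    (fun t => cpow (t - x) (z - 1) * (expR (- (p * (t - x) `^ k)))%:C) =
  cpow p (- (z / k%:C)) / z * Gamma_int (z / k%:C + 1).
Proof.
move=> z0.
have kn0 : k != 0 by rewrite gt_eqF.
have RezD t : x < t -> normc (cpow (t - x) (z - 1)) = (t - x) `^ (Re z - 1).
  by move=> xt; rewrite normc_cpow ?subr_gt0// ReD ReN.
have mcpow : cmeasurable setT (fun t : R => cpow (t - x) (z - 1)).
  apply: cmeasurable_cpow; apply: measurable_funB => //; exact: measurable_cst.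
transitivity (cintegral `]x, +oo[ (fun t => cintegral `]0, +oo[ (fun y =>
    cpow (t - x) (z - 1) * (g (t, y))%:C))).
  apply: eq_cintegral => t /=; rewrite in_itv/= andbT => xt.
  rewrite cintegralZl//; last first.
    split => /=; last exact: integrable0.
    apply/integrableP; split.
      apply/measurable_funTS/measurable_EFinP.
      exact: measurableT_comp mg (pair1_measurable t).
    under eq_integral do rewrite /= ger0_norm//.
    by rewrite integral_if superlevel// integral_expRN ltry.
  by rewrite cintegralC Rintegral_g.
rewrite (@cfubini_on _ _ _ _ _ (fun u => cpow (u.1 - x) (z - 1) * (g u)%:C))//; last 2 first.
- apply: cmeasurableM; last exact: cmeasurable_real.
  by split; [exact: measurableT_comp mcpow.1 measurable_fst|
             exact: measurableT_comp mcpow.2 measurable_fst].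
- have -> : (\int[mu]_(t in `]x, +oo[) \int[mu]_(y in `]0%R, +oo[)
      (normc (cpow (t - x) (z - 1) * (g (t, y))%:C))%:E =
    \int[mu]_(t in `]x, +oo[) \int[mu]_(y in `]0%R, +oo[)
      ((t - x) `^ (Re z - 1) * g (t, y))%:E)%E.
    apply: eq_integral => t; rewrite inE/= in_itv/= andbT => xt.
    by apply: eq_integral => y _; rewrite normcM RezD// normcC ger0_norm.
  have fin := integral_powR_expR_lty (divr_gt0 z0 k0).
  rewrite integral_g integral_powR_stretched// lte_mul_pinfty// ?lee_fin//.
  by rewrite divr_ge0 ?powR_ge0 ?ltW.
rewrite /Gamma_int -cintegralZl//; last first.
  have := @cintegrable_cpow_expR (z / k%:C); rewrite Re_divC divr_gt0// => /(_ isT).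
  by apply: eq_cintegrable => // y _; rewrite addrK.
apply: eq_cintegral => y /=; rewrite in_itv/= andbT => y0.
transitivity (cintegral `]x, +oo[ (fun t =>
   (expR (- y))%:C * (if q t <= y then cpow (t - x) (z - 1) else 0))).
  apply: eq_cintegral => t _; rewrite /g/=; case: ifP => _.
  - by rewrite mulrC.
  - by rewrite !mulr0.
rewrite cintegralZl//; last first.
  apply: normc_fin_cintegrable => //.
    apply/cmeasurable_funTS/cmeasurable_if => //.
    by apply: measurable_fun_ler => //; exact: measurable_cst.
  have <- : (\int[mu]_(t in `]x, +oo[)
      (if (q t <= y)%R then (t - x) `^ (Re z - 1) else 0)%:E =
      \int[mu]_(t in `]x, +oo[)
      (normc (if (q t <= y)%R then cpow (t - x) (z - 1) else 0))%:E)%E.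
    apply: eq_integral => t; rewrite inE/= in_itv/= andbT => xt.
    by case: ifP => _; rewrite ?RezD// normc0.
  by rewrite integral_if sublevel// integral_powR ?ltry// ltrDl r_gt0.
rewrite cintegral_if sublevel// cintegral_cpow//; last by rewrite ltrDl r_gt0.
rewrite (_ : x + r y - x = r y); last by ring.
rewrite /r cpow_powR ?divr_gt0// cpowM ?invr_gt0// cpowV// addrK.
rewrite fmorphV (mulrC _^-1 z) mulrAC.
ring.
Qed.

End StretchedExponential.

Section EulerIntegrals.
Variable R : realType.
Local Notation mu := (@lebesgue_measure R).

Lemma integral_laplace (x p a : R) : 0 < p -> 0 < a ->
  (\int[mu]_(t in `]x, +oo[) ((t - x) `^ (a - 1) * expR (- (p * (t - x))))%:E =
   (p `^ (- a) / a)%:E * \int[mu]_(y in `]0%R, +oo[) (y `^ a * expR (- y))%:E)%E.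
Proof.
move=> p0 a0; have := integral_powR_stretched x p0 (@ltr01 R) a0.
rewrite divr1 => <-; apply: eq_integral => t; rewrite inE/= in_itv/= andbT => xt.
by rewrite powRr1// subr_ge0 ltW.
Qed.

Lemma cintegrable_laplace (x p : R) (z : R[i]) : 0 < p -> 0 < Re z ->
  cintegrable `]x, +oo[
    (fun t => cpow (t - x) (z - 1) * (expR (- (p * (t - x))))%:C).
Proof.
move=> p0 z0; apply: eq_cintegrable (cintegrable_stretched x p0 (@ltr01 R) z0) => //.
by move=> t /=; rewrite in_itv/= andbT => xt; rewrite powRr1// subr_ge0 ltW.
Qed.

Let cintegral_laplace1 (x p : R) (z : R[i]) : 0 < p -> 0 < Re z ->
  cintegral `]x, +oo[
    (fun t => cpow (t - x) (z - 1) * (expR (- (p * (t - x))))%:C) =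
  cpow p (- z) / z * Gamma_int (z + 1).
Proof.
move=> p0 z0; have := cintegral_stretched x p0 (@ltr01 R) z0.
rewrite divr1 => <-; apply: eq_cintegral => t /=; rewrite in_itv/= andbT => xt.
by rewrite powRr1// subr_ge0 ltW.
Qed.

(** Euler's integral is the stretched exponential integral with p = k = 1, so
    the layer-cake formula is its functional equation. *)
Lemma Gamma_intS (z : R[i]) : 0 < Re z -> Gamma_int (z + 1) = z * Gamma_int z.
Proof.
move=> z0; have zn0 : z != 0 by apply: contraTneq z0 => ->; rewrite ltxx.
have -> : Gamma_int z = cpow 1 (- z) / z * Gamma_int (z + 1).
  rewrite -[RHS](cintegral_laplace1 0 ltr01 z0); apply: eq_cintegral => t _.
  by rewrite subr0 mul1r.
by rewrite cpow1 mul1r mulVKf.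
Qed.

Lemma cintegral_laplace (x p : R) (z : R[i]) : 0 < p -> 0 < Re z ->
  cintegral `]x, +oo[
    (fun t => cpow (t - x) (z - 1) * (expR (- (p * (t - x))))%:C) =
  cpow p (- z) * Gamma_int z.
Proof.
move=> p0 z0; have zn0 : z != 0 by apply: contraTneq z0 => ->; rewrite ltxx.
by rewrite cintegral_laplace1// Gamma_intS// -mulrA mulKf.
Qed.

(** The layer-cake formula with p = 1 / k, followed by the functional equation. *)
Lemma kGamma_intE (k : R) (z : R[i]) : 0 < k -> 0 < Re z ->
  kGamma k z = cpow k (z / k%:C - 1) * Gamma_int (z / k%:C).
Proof.
move=> k0 z0; have zn0 : z != 0 by apply: contraTneq z0 => ->; rewrite ltxx.
have kn0 : k%:C != 0 by rewrite fmorph_eq0 gt_eqF.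
rewrite /kGamma z0.
have := cintegral_stretched 0 (p := k^-1) (k := k) _ k0 z0.
rewrite invr_gt0 => /(_ k0) => E.
transitivity (cpow k^-1 (- (z / k%:C)) / z * Gamma_int (z / k%:C + 1)).
  by rewrite -E; apply: eq_cintegral => t _; rewrite subr0 (mulrC k^-1).
rewrite cpowV// opprK Gamma_intS ?Re_divC ?divr_gt0// cpowD cpowN.
rewrite (_ : cpow k 1 = k%:C); last by rewrite (cpow_natr 1).
by field; rewrite kn0 zn0.
Qed.

Lemma Gamma_int1 : Gamma_int 1 = 1 :> R[i].
Proof.
rewrite /Gamma_int subrr.
rewrite (@eq_cintegral _ _ _ (fun t => (expR (- t))%:C)); last first.
  by move=> t _; rewrite cpow0 mul1r.
rewrite cintegralC /Rintegral integral_itv_obnd_cbnd; last first.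
  by apply/measurable_EFinP/measurable_funTS; exact: measurableT_comp.
by rewrite integral_expRN oppr0 expR0.
Qed.

(** ** The beta integral *)

(** On [1, 2] the integrand is bounded below by a positive constant. *)
Lemma integral_powR_expR_gt0 (a : R) :
  (0 < \int[mu]_(y in `]0%R, +oo[) (y `^ a * expR (- y))%:E)%E.
Proof.
have mf : measurable_fun setT (fun y : R => (y `^ a * expR (- y))%:E).
  apply/measurable_EFinP; apply: measurable_funM; first exact: measurable_powR.
  by apply: measurableT_comp => //; exact: measurableT_comp.
apply: lt_le_trans (_ : (0 < (expR (- `|a|) * expR (- 2))%:E)%E) _.
  by rewrite lte_fin mulr_gt0 ?expR_gt0.
apply: le_trans (_ : _ <= \int[mu]_(y in `[1%R, 2%R]) (y `^ a * expR (- y))%:E)%E _; last first.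
  apply: ge0_subset_integral => //.
  - exact: measurable_funTS.
  - by move=> y _; rewrite lee_fin mulr_ge0 ?powR_ge0 ?expR_ge0.
  - move=> y /=; rewrite !in_itv/= andbT => /andP[y1 _]; exact: lt_le_trans y1.
have -> : (expR (- `|a|) * expR (- 2))%:E =
    (\int[mu]_(y in `[1%R, 2%R]) (expR (- `|a|) * expR (- 2))%:E)%E.
  rewrite integral_cst//= lebesgue_measure_itv/= lte_fin ltr1n -EFinD.
  by rewrite (_ : 2 - 1 = 1 :> R) ?mule1//; ring.
apply: ge0_le_integral => //.
  exact: measurable_funTS.
move=> y /=; rewrite in_itv/= => /andP[y1 y2].
have y0 : 0 < y by exact: lt_le_trans y1.
rewrite lee_fin ler_pM ?expR_ge0// ?ler_expR ?lerN2//.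
rewrite gt0_powRE// ler_expR.
have ln0 := ln_ge0 y1.
have ln1 : ln y <= 1.
  have := @le_ln1Dx R (y - 1); rewrite (addrC 1) subrK ltrBrDl subrr y0 => /(_ isT).
  by move=> /le_trans; apply; rewrite lerBlDl.
rewrite lerNl -mulNr (le_trans (ler_norm _))// normrM normrN.
by rewrite ler_piMr// ger0_norm.
Qed.

End EulerIntegrals.

Section Beta.
Variable R : realType.
Local Notation mu := (@lebesgue_measure R).

Let mE : measurable_fun setT (fun u : R * R => expR (- (u.1 * u.2))).
Proof.
apply: measurableT_comp => //; apply: measurableT_comp => //.
by apply: measurable_funM; [exact: measurable_fst|exact: measurable_snd].
Qed.

Let mpow (x a : R) : measurable_fun setT (fun u : R * R => (u.1 - x) `^ a).
Proof.
apply: (measurableT_comp (measurable_powR a)).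
by apply: measurable_funB; [exact: measurable_fst|exact: measurable_cst].
Qed.

Let mpow2 (a : R) : measurable_fun setT (fun u : R * R => u.2 `^ a).
Proof. exact: measurableT_comp (measurable_powR a) measurable_snd. Qed.

Let G (a : R) := (\int[mu]_(y in `]0%R, +oo[) (y `^ a * expR (- y))%:E)%E.

Let G_gt0 a : (0 < G a)%E. Proof. exact: integral_powR_expR_gt0. Qed.

Let G_fin a : 0 < a -> (G a < +oo)%E. Proof. exact: integral_powR_expR_lty. Qed.

(* The kernel whose two iterated integrals are the two sides of the beta
   identity. *)
Let h (x a b : R) (u : R * R) :=
  (u.1 - x) `^ (a - 1) * (u.2 `^ (b - 1) * expR (- (u.1 * u.2))).

Let mh x a b : measurable_fun setT (h x a b).
Proof. by apply: measurable_funM => //; exact: measurable_funM. Qed.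

Let h_ge0 x a b u : 0 <= h x a b u.
Proof. by rewrite /h !mulr_ge0 ?powR_ge0 ?expR_ge0. Qed.

Let expR_shift (x t u : R) :
  expR (- (t * u)) = expR (- (x * u)) * expR (- (u * (t - x))).
Proof. by rewrite -expRD; congr expR; ring. Qed.

Let laplace0 (p b : R) : 0 < p -> 0 < b ->
  (\int[mu]_(u in `]0%R, +oo[) (u `^ (b - 1) * expR (- (p * u)))%:E =
   (p `^ (- b) / b)%:E * G b)%E.
Proof.
move=> p0 b0; rewrite -(integral_laplace 0 p0 b0).
by apply: eq_integral => u _; rewrite subr0.
Qed.

(* The t-integral carries a factor 1 / b, because the Laplace transform of
   u^(b - 1) is expressed through G b = Gamma(b + 1) = b Gamma(b). *)
Let iterated_t (x a b : R) : 0 < x -> 0 < b ->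
  (\int[mu]_(t in `]x, +oo[) \int[mu]_(u in `]0%R, +oo[) (h x a b (t, u))%:E =
   G b * \int[mu]_(t in `]x, +oo[) ((t - x) `^ (a - 1) * (t `^ (- b) / b))%:E)%E.
Proof.
move=> x0 b0; rewrite -ge0_integralZl//; last 3 first.
- apply/measurable_funTS/measurable_EFinP; apply: measurable_funM.
    exact: measurableT_comp (mpow x (a - 1)) (pair2_measurable x).
  by apply: measurable_funM; [exact: measurable_powR|exact: measurable_cst].
- by move=> t _; rewrite lee_fin mulr_ge0 ?divr_ge0 ?powR_ge0 ?ltW.
- exact: ltW.
apply: eq_integral => t; rewrite inE/= in_itv/= andbT => xt.
transitivity (\int[mu]_(u in `]0%R, +oo[)
    (((t - x) `^ (a - 1))%:E * (u `^ (b - 1) * expR (- (t * u)))%:E))%E.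
  by apply: eq_integral => u _; rewrite -EFinM.
rewrite ge0_integralZl_EFin ?powR_ge0//; last 2 first.
- by move=> u _; rewrite lee_fin mulr_ge0 ?powR_ge0 ?expR_ge0.
- apply/measurable_funTS/measurable_EFinP; apply: measurable_funM.
    exact: measurable_powR.
  exact: measurableT_comp mE (pair1_measurable t).
by rewrite (laplace0 (lt_trans x0 xt) b0) muleA -EFinM muleC.
Qed.

Let iterated_u_fin (x a b : R) : 0 < x -> 0 < a -> a < b ->
  (\int[mu]_(u in `]0%R, +oo[) \int[mu]_(t in `]x, +oo[) (h x a b (t, u))%:E < +oo)%E.
Proof.
move=> x0 a0 ab.
have ba0 : 0 < b - a by rewrite subr_gt0.
have powE (u e : R) : 0 < u ->
    u `^ (b - 1) * e * (u `^ (- a) / a) = a^-1 * (u `^ (b - a - 1) * e).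
  move=> u0; rewrite (_ : b - a - 1 = (b - 1) + - a); last by ring.
  by rewrite (gt0_powRD (b - 1) (- a) u0); ring.
have mi : measurable_fun setT (fun u : R =>
    (u `^ (b - a - 1) * expR (- (x * u)))%:E).
  apply/measurable_EFinP; apply: measurable_funM; first exact: measurable_powR.
  exact: measurableT_comp mE (pair1_measurable x).
rewrite (_ : (\int[mu]_(u in _) _)%E =
  ((a^-1)%:E * G a * \int[mu]_(u in `]0%R, +oo[)
     (u `^ (b - a - 1) * expR (- (x * u)))%:E)%E); last first.
  rewrite -ge0_integralZl//; last 3 first.
  - exact: measurable_funTS.
  - by move=> u _; rewrite lee_fin mulr_ge0 ?powR_ge0 ?expR_ge0.
  - by rewrite mule_ge0 ?lee_fin ?invr_ge0 ?ltW.
  apply: eq_integral => u; rewrite inE/= in_itv/= andbT => u0.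
  transitivity (\int[mu]_(t in `]x, +oo[) ((u `^ (b - 1) * expR (- (x * u)))%:E *
      ((t - x) `^ (a - 1) * expR (- (u * (t - x))))%:E))%E.
    apply: eq_integral => t _; rewrite -EFinM; congr EFin.
    by rewrite /h/= (expR_shift x t u); ring.
  rewrite ge0_integralZl_EFin ?mulr_ge0 ?powR_ge0 ?expR_ge0//; last 2 first.
  - by move=> t _; rewrite lee_fin mulr_ge0 ?powR_ge0 ?expR_ge0.
  - apply/measurable_funTS/measurable_EFinP; apply: measurable_funM.
      exact: measurableT_comp (mpow x (a - 1)) (pair2_measurable x).
    under eq_fun do rewrite mulrC.
    apply: measurableT_comp => //; apply: measurableT_comp => //.
    apply: measurable_funM; last exact: measurable_cst.
    by apply: measurable_funB => //; exact: measurable_cst.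
  rewrite (integral_laplace x u0 a0) -/(G a) muleA -EFinM [RHS]muleAC -EFinM.
  by rewrite powE.
rewrite (laplace0 x0 ba0).
have GE c : 0 < c -> exists g : R, G c = g%:E.
  move=> c0; exists (fine (G c)); rewrite fineK// ge0_fin_numE ?G_fin//.
  exact: ltW.
have [g1 ->] := GE _ a0; have [g2 ->] := GE _ ba0.
by rewrite -!EFinM ltry.
Qed.

Let iterated_t_fin (x a b : R) : 0 < x -> 0 < a -> a < b ->
  (\int[mu]_(t in `]x, +oo[) \int[mu]_(u in `]0%R, +oo[) (h x a b (t, u))%:E < +oo)%E.
Proof.
move=> x0 a0 ab.
have := tonelli_on (measurable_itv `]x, +oo[) (measurable_itv `]0, +oo[) (mh x a b)
  (fun t u _ _ => h_ge0 x a b (t, u)).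
by move=> ->; exact: iterated_u_fin.
Qed.

(** Up to a factor, the finite double integral of the kernel is the integral of
    the modulus multiplied by G (Re (s + a)), which is positive; so that integral
    cannot be infinite. *)
Lemma cintegrable_beta (x : R) (a s : R[i]) : 0 < x -> 0 < Re a -> 0 < Re s ->
  cintegrable `]x, +oo[ (fun t => cpow (t - x) (a - 1) * cpow t (- (s + a))).
Proof.
move=> x0 a0 s0.
have b0 : 0 < Re (s + a) by rewrite ReD addr_gt0.
have ab : Re a < Re (s + a) by rewrite ReD ltrDr.
have Bfin : (\int[mu]_(t in `]x, +oo[)
    ((t - x) `^ (Re a - 1) * (t `^ (- Re (s + a)) / Re (s + a)))%:E < +oo)%E.
  rewrite ltNge leye_eq; apply/negP => /eqP Boo.
  have := iterated_t_fin x0 a0 ab.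
  by rewrite iterated_t// Boo gt0_muley// ltxx.
apply: normc_fin_cintegrable => //.
  apply: cmeasurableM; apply: cmeasurable_cpow => //.
  by apply: measurable_funB => //; exact: measurable_cst.
have bn0 : Re (s + a) != 0 by rewrite gt_eqF.
rewrite (_ : (\int[mu]_(t in _) _)%E = ((Re (s + a))%:E * \int[mu]_(t in `]x, +oo[)
    ((t - x) `^ (Re a - 1) * (t `^ (- Re (s + a)) / Re (s + a)))%:E)%E); last first.
  rewrite -ge0_integralZl_EFin ?(ltW b0)//; last 2 first.
  - by move=> t _; rewrite lee_fin mulr_ge0 ?divr_ge0 ?powR_ge0 ?(ltW b0).
  - apply/measurable_funTS/measurable_EFinP; apply: measurable_funM.
      exact: measurableT_comp (mpow x (Re a - 1)) (pair2_measurable x).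
    by apply: measurable_funM; [exact: measurable_powR|exact: measurable_cst].
  apply: eq_integral => t; rewrite inE/= in_itv/= andbT => xt.
  rewrite normcM normc_cpow ?subr_gt0// normc_cpow ?(lt_trans x0)//.
  rewrite (ReN (s + a)) (_ : Re (a - 1) = Re a - 1) -?EFinM; last by rewrite ReD ReN.
  by rewrite [in RHS]mulrC -!mulrA mulVf// mulr1.
by rewrite lte_mul_pinfty// lee_fin ltW.
Qed.

Let ch (x : R) (a b : R[i]) (u : R * R) :=
  cpow (u.1 - x) (a - 1) * (cpow u.2 (b - 1) * (expR (- (u.1 * u.2)))%:C).

Let normc_ch (x : R) (a b : R[i]) (t u : R) : x < t -> 0 < u ->
  normc (ch x a b (t, u)) = h x (Re a) (Re b) (t, u).
Proof.
move=> xt u0; have tx0 : 0 < t - x by rewrite subr_gt0.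
rewrite -[ch _ _ _ _]/(cpow (t - x) (a - 1) *
  (cpow u (b - 1) * (expR (- (t * u)))%:C)).
rewrite normcM (normcM (cpow u _)) (normc_cpow _ tx0) (normc_cpow _ u0) normcC ger0_norm ?expR_ge0//.
by rewrite !ReD !ReN.
Qed.

(** In the double integral of (t - x)^(a - 1) u^(s + a - 1) exp (- t u), the
    u-integral is Gamma(s + a) t^(- (s + a)).  The t-integral, after the
    factorization exp (- t u) = exp (- x u) exp (- u (t - x)), is
    exp (- x u) Gamma(a) u^(- a), and what remains is a Laplace transform at x. *)
Lemma cintegral_beta (x : R) (a s : R[i]) : 0 < x -> 0 < Re a -> 0 < Re s ->
  Gamma_int (s + a) *
    cintegral `]x, +oo[ (fun t => cpow (t - x) (a - 1) * cpow t (- (s + a))) =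
  cpow x (- s) * (Gamma_int a * Gamma_int s).
Proof.
move=> x0 a0 s0.
have b0 : 0 < Re (s + a) by rewrite ReD addr_gt0.
have ab : Re a < Re (s + a) by rewrite ReD ltrDr.
transitivity (cintegral `]x, +oo[ (fun t => cintegral `]0, +oo[
    (fun u => ch x a (s + a) (t, u)))).
  rewrite -cintegralZl//; last exact: cintegrable_beta.
  apply: eq_cintegral => t /=; rewrite in_itv/= andbT => xt.
  have t0 := lt_trans x0 xt.
  rewrite [RHS](@cintegralZl _ _ (fun u => cpow u (s + a - 1) * (expR (- (t * u)))%:C)
    (cpow (t - x) (a - 1)))//; last first.
    apply: eq_cintegrable (cintegrable_laplace 0 t0 b0) => // u _.
    by rewrite subr0.
  have := cintegral_laplace 0 t0 b0.
  rewrite (eq_cintegral (g := fun u => cpow u (s + a - 1) * (expR (- (t * u)))%:C)).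
    by move=> ->; ring.
  by move=> u _; rewrite subr0.
rewrite cfubini_on//; last 2 first.
- apply: cmeasurableM; first apply: cmeasurable_cpow.
    by apply: measurable_funB; [exact: measurable_fst|exact: measurable_cst].
  apply: cmeasurableM; last exact: cmeasurable_real.
  by apply: cmeasurable_cpow; exact: measurable_snd.
- apply: le_lt_trans (iterated_t_fin x0 a0 ab); rewrite le_eqVlt; apply/orP; left; apply/eqP.
  apply: eq_integral => t; rewrite inE/= in_itv/= andbT => xt.
  apply: eq_integral => u; rewrite inE/= in_itv/= andbT => u0.
  by rewrite normc_ch.
transitivity (cintegral `]0, +oo[ (fun u =>
    Gamma_int a * (cpow (u - 0) (s - 1) * (expR (- (x * (u - 0))))%:C))).
  apply: eq_cintegral => u /=; rewrite in_itv/= andbT => u0.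
  transitivity (cintegral `]x, +oo[ (fun t =>
     (cpow u (s + a - 1) * (expR (- (x * u)))%:C) *
     (cpow (t - x) (a - 1) * (expR (- (u * (t - x))))%:C))).
    apply: eq_cintegral => t _; rewrite /ch/= (expR_shift x t u) rmorphM/=; ring.
  rewrite cintegralZl//; last exact: cintegrable_laplace.
  rewrite cintegral_laplace// subr0 (_ : s - 1 = s + a - 1 - a); last by ring.
  by rewrite [in RHS]cpowD; ring.
rewrite cintegralZl//; last exact: cintegrable_laplace.
rewrite cintegral_laplace//; ring.
Qed.

End Beta.

(** * The Gamma function off the half-plane *)

Section Nonvanishing.
Variable R : realType.
Local Notation mu := (@lebesgue_measure R).

Let Gamma_int_half (z : R[i]) : 0 < Re z -> Gamma_int z = 0 -> Gamma_int (z / 2) = 0.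
Proof.
move=> z0 Gz; have h0 : 0 < Re (z / 2).
  by rewrite (_ : 2 = (2 : R)%:C) ?Re_divC ?divr_gt0// natrC.
have := cintegral_beta ltr01 h0 h0; rewrite -splitr Gz mul0r cpow1 mul1r.
by move=> /esym/eqP; rewrite mulf_eq0 orbb => /eqP.
Qed.

(* The successive halves z / 2^n. *)
Let w (z : R[i]) n := z * (2^-1 ^+ n)%:C.

Let w_gt0 z n : 0 < Re z -> 0 < Re (w z n).
Proof. by move=> z0; rewrite /w mulrC ReMC mulr_gt0// exprn_gt0. Qed.

Let Gamma_int_w (z : R[i]) n : 0 < Re z -> Gamma_int z = 0 -> Gamma_int (w z n) = 0.
Proof.
move=> z0 Gz; elim: n => [|n ih]; first by rewrite /w expr0 mulr1.
have := Gamma_int_half (w_gt0 n z0) ih; congr (Gamma_int _ = 0).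
by rewrite /w exprSr rmorphM/= fmorphV/= rmorph_nat mulrA.
Qed.

Let w_cvg0 (r : R) : (fun n => r * 2^-1 ^+ n) @ \oo --> (0 : R).
Proof.
rewrite -(mulr0 r); apply: cvgMl_tmp; apply: cvg_expr.
by rewrite ger0_norm// invf_lt1// ltr1n.
Qed.

Let cpow_w_cvg1 (z : R[i]) (t : R) : ccvg (fun n => cpow t (w z n)) 1.
Proof.
pose c := z * (ln t)%:C.
have cvg_w (f : R -> R) r : continuous f -> f (r * 2^-1 ^+ n) @[n --> \oo] --> f 0.
  by move=> cf; apply: continuous_cvg; [exact: cf|exact: w_cvg0].
have wE n : cpow t (w z n) = (expR (Re c * 2^-1 ^+ n))%:C *
    (cos (Im c * 2^-1 ^+ n) +i* sin (Im c * 2^-1 ^+ n)).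
  rewrite /cpow (_ : w z n * _ = (2^-1 ^+ n)%:C * c); last by rewrite /w /c; ring.
  by rewrite /cexp ReMC ImMC ![_ * 2^-1 ^+ n]mulrC.
have cE := cvg_w _ (Re c) (@continuous_expR R).
have cRe := cvgM cE (cvg_w _ (Im c) (@continuous_cos R)).
have cIm := cvgM cE (cvg_w _ (Im c) (@continuous_sin R)).
rewrite expR0 cos0 mulr1 in cRe; rewrite sin0 mulr0 in cIm.
split; under eq_fun do rewrite wE (ReMC, ImMC) /=; [exact: cRe|exact: cIm].
Qed.

(** A zero z propagates to all z / 2^n, hence to z / 2^n + 1 by the functional
    equation.  Dominated convergence of Euler's integrals, with majorant
    (1 + t^(Re z)) exp (- t), then gives Gamma(1) = 0. *)
Lemma Gamma_int_neq0 (z : R[i]) : 0 < Re z -> Gamma_int z != 0.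
Proof.
move=> z0; apply/eqP => Gz.
have G0 n : Gamma_int (w z n + 1) = 0.
  by rewrite Gamma_intS ?w_gt0// Gamma_int_w// mulr0.
pose h (t : R) : R := expR (- t) + t `^ Re z * expR (- t).
have mE : measurable_fun setT (fun t : R => expR (- t)).
  by apply: measurableT_comp => //; exact: measurableT_comp.
have ih : mu.-integrable `]0, +oo[ (EFin \o h).
  pose h1 (t : R) := (expR (- t))%:E; pose h2 t := (t `^ Re z * expR (- t))%:E.
  rewrite (_ : EFin \o h = (h1 \+ h2)%E) //.
  apply: integrableD => //.
  - apply/integrableP; split; first exact/measurable_funTS/measurable_EFinP.
    under eq_integral do rewrite /= ger0_norm ?expR_ge0//.
    rewrite integral_itv_obnd_cbnd; last exact/measurable_funTS/measurable_EFinP.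
    by rewrite integral_expRN ltry.
  - apply/integrableP; split.
      by apply/measurable_funTS/measurable_EFinP; exact: measurable_funM.
    under eq_integral do rewrite /h2/= ger0_norm ?mulr_ge0 ?powR_ge0 ?expR_ge0//.
    exact: integral_powR_expR_lty.
have [] := @cdominated_convergence R `]0, +oo[%classic
  (fun n t => cpow t (w z n + 1 - 1) * (expR (- t))%:C) (fun t => (expR (- t))%:C) h.
- by [].
- move=> n; apply: cmeasurableM; first exact: cmeasurable_cpow.
  exact/cmeasurable_real/measurable_funTS.
- move=> t /=; rewrite in_itv/= andbT => t0.
  rewrite -[X in ccvg _ X]mulr1.
  under [X in ccvg X _]funext do rewrite addrK mulrC.
  by apply: ccvgZl; exact: cpow_w_cvg1.
- exact: ih.
- move=> n t /=; rewrite in_itv/= andbT => t0.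
  rewrite normcM normc_cpow// normcC ger0_norm ?expR_ge0// addrK.
  rewrite /h -[X in _ <= X + _]mul1r -mulrDl ler_wpM2r ?expR_ge0//.
  rewrite [w z n]mulrC ReMC.
  have q1 : 2^-1 ^+ n * Re z <= Re z.
    by rewrite ler_piMl ?(ltW z0)// exprn_ile1 ?invf_le1 ?ler1n.
  have [t1|t1] := leP 1 t.
    by rewrite ler_wpDl// ler_powR.
  rewrite ler_wpDr ?powR_ge0// -[X in _ <= X](powRr0 t) ger_powR ?t0 ?(ltW t1)//.
  by rewrite mulr_ge0 ?exprn_ge0 ?invr_ge0 ?(ltW z0).
move=> _ cvgG.
have G1 : cintegral `]0, +oo[ (fun t : R => (expR (- t))%:C) = 1.
  rewrite -Gamma_int1; apply: eq_cintegral => t _.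
  by rewrite subrr cpow0 mul1r.
have : ccvg (fun=> 0) (1 : R[i]).
  rewrite -G1; move: cvgG; congr (ccvg _ _); apply/funext => n.
  exact: G0.
have c0 : ccvg (fun=> 0) (0 : R[i]) by split; exact: cvg_cst.
by move=> /(ccvg_unique c0)/eqP; rewrite eq_sym oner_eq0.
Qed.

End Nonvanishing.

Section Pochhammer.
Variable R : realType.
Implicit Types (z s : R[i]) (n m N : nat).

Lemma pochhammer0 z : pochhammer z 0 = 1.
Proof. by rewrite /pochhammer big_ord0. Qed.

Lemma pochhammerS z n : pochhammer z n.+1 = pochhammer z n * (z + n%:R).
Proof. by rewrite /pochhammer big_ord_recr. Qed.

Lemma pochhammerD z m n :
  pochhammer z (m + n) = pochhammer z m * pochhammer (z + m%:R) n.
Proof.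
elim: n => [|n ih]; first by rewrite addn0 pochhammer0 mulr1.
by rewrite addnS !pochhammerS ih -mulrA -addrA -natrD.
Qed.

Lemma pochhammer_neq0 z n : ~ nonpositive_integer z -> pochhammer z n != 0.
Proof.
move=> zN; elim: n => [|n ih]; first by rewrite pochhammer0 oner_neq0.
rewrite pochhammerS mulf_neq0//; apply/eqP => zn0; apply: zN; exists n.
by apply/eqP; rewrite -addr_eq0 zn0.
Qed.

(** Even and odd factors of (s)_(2n), halved. *)
Lemma pochhammer_double s n :
  pochhammer s (2 * n) =
  4 ^+ n * (pochhammer (s / 2) n * pochhammer ((s + 1) / 2) n).
Proof.
elim: n => [|n ih]; first by rewrite muln0 !pochhammer0 !mulr1.
rewrite mulnS add2n !pochhammerS ih exprS -[in RHS]natr1 -natr1 natrM.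
by field.
Qed.

Lemma Re_gt0_not_nonpositive z : 0 < Re z -> ~ nonpositive_integer z.
Proof.
move=> z0 [n zE]; move: z0; rewrite zE ReN Re_natr oppr_gt0.
by rewrite ltNge ler0n.
Qed.

Lemma Gamma_int_pochhammer z n : 0 < Re z ->
  Gamma_int (z + n%:R) = pochhammer z n * Gamma_int z.
Proof.
move=> z0; elim: n => [|n ih]; first by rewrite addr0 pochhammer0 mul1r.
rewrite -natr1 addrA Gamma_intS; last by rewrite ReD Re_natr ltr_wpDr.
by rewrite ih pochhammerS mulrCA mulrA.
Qed.

(** The value of Gamma does not depend on how far the argument is shifted into
    the half-plane of convergence of Euler's integral. *)
Lemma Gamma_shift z n : ~ nonpositive_integer z -> 0 < Re (z + n%:R) ->
  Gamma_int (z + n%:R) = pochhammer z n * Gamma z.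
Proof.
move=> zN zn0; rewrite /Gamma; case: ifPn => [z0|]; first exact: Gamma_int_pochhammer.
rewrite -leNgt => z0; set N := (Num.truncn _).+1.
have zN0 : 0 < Re (z + N%:R).
  rewrite ReD Re_natr -ltrBlDl sub0r.
  by have := truncnS_gt (- Re z).
have pN0 := pochhammer_neq0 N zN.
have : pochhammer (z + n%:R) N * Gamma_int (z + n%:R) =
       pochhammer (z + N%:R) n * Gamma_int (z + N%:R).
  by rewrite -!Gamma_int_pochhammer// addrAC.
have znN : pochhammer (z + n%:R) N != 0.
  exact/pochhammer_neq0/Re_gt0_not_nonpositive.
move=> E; apply: (mulfI znN); rewrite E.
have := pochhammerD z n N; rewrite addnC pochhammerD => E2.
apply: (mulfI pN0); rewrite [LHS]mulrA E2.
by field.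
Qed.

Lemma GammaD z n : ~ nonpositive_integer z ->
  Gamma (z + n%:R) = pochhammer z n * Gamma z.
Proof.
move=> zN.
have znN : ~ nonpositive_integer (z + n%:R).
  move=> [m zE]; apply: zN; exists (n + m)%N.
  by rewrite natrD opprD -zE addrC addrK.
pose N := (Num.truncn (- Re z)).+1.
have zN0 : 0 < Re (z + n%:R + N%:R).
  rewrite !ReD !Re_natr addrAC ltr_wpDr// -ltrBlDl sub0r.
  exact: truncnS_gt.
have := Gamma_shift znN zN0; rewrite -addrA -natrD Gamma_shift//; last first.
  by rewrite natrD addrA.
rewrite pochhammerD -mulrA mulrCA.
by move=> /(mulfI (pochhammer_neq0 N znN)).
Qed.

Lemma GammaE z : 0 < Re z -> Gamma z = Gamma_int z.
Proof. by rewrite /Gamma => ->. Qed.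

Lemma Gamma_neq0 z : ~ nonpositive_integer z -> Gamma z != 0.
Proof.
move=> zN; pose N := (Num.truncn (- Re z)).+1.
have zN0 : 0 < Re (z + N%:R).
  by rewrite !ReD !Re_natr -ltrBlDl sub0r; exact: truncnS_gt.
have := Gamma_int_neq0 zN0; rewrite Gamma_shift//.
by rewrite mulf_eq0 negb_or => /andP[].
Qed.

Lemma kGammaE (k : R) z : 0 < k ->
  kGamma k z = cpow k (z / k%:C - 1) * Gamma (z / k%:C).
Proof.
move=> k0; rewrite {1}/kGamma; case: ifPn => // z0.
transitivity (kGamma k z); first by rewrite /kGamma z0.
by rewrite kGamma_intE// GammaE// Re_divC divr_gt0.
Qed.

End Pochhammer.

(** * The series of the k-Bessel function *)

Section BesselSeries.
Variable R : realType.
Implicit Types (z : R[i]) (n m N : nat).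

(** From index N on, every further factor z + n has real part at least 1, so
    the modulus of the symbol no longer decreases. *)
Lemma inv_pochhammer_bounded z : ~ nonpositive_integer z ->
  exists2 D : R, 0 <= D & forall n, normc (pochhammer z n)^-1 <= D.
Proof.
move=> zN; pose N := (Num.truncn (- Re z)).+2.
have farther n : normc (pochhammer z (N + n))^-1 <= normc (pochhammer z N)^-1.
  elim: n => [|n ih]; first by rewrite addn0.
  rewrite addnS pochhammerS invfM normcM; apply: le_trans ih.
  rewrite ler_piMr ?normc_ge0// normcV invf_le1.
  - apply: le_trans (normc_Re _); apply: le_trans (ler_norm _).
    rewrite ReD Re_natr /N addSn -natr1 addrA lerDr.
    rewrite -lerBlDl sub0r natrD; apply: le_trans (ltW (truncnS_gt _)) _.
    by rewrite lerDl.
  - apply: normc_gt0; apply/eqP => zn0; apply: zN; exists (N + n)%N.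
    by apply/eqP; rewrite -addr_eq0 zn0.
exists (\sum_(0 <= i < N.+1) normc (pochhammer z i)^-1).
  by apply: sumr_ge0 => i _; exact: normc_ge0.
have nearer n : (n <= N)%N ->
    normc (pochhammer z n)^-1 <= \sum_(0 <= i < N.+1) normc (pochhammer z i)^-1.
  move=> nN; rewrite (bigD1_seq n) ?mem_index_iota ?iota_uniq//.
  by rewrite lerDl sumr_ge0// => i _; exact: normc_ge0.
move=> n; have [nN|/ltnW nN] := leqP n N; first exact: nearer.
by rewrite -(subnKC nN); apply: le_trans (farther _) (nearer _ (leqnn _)).
Qed.

Variables (k c : R) (v : R[i]).
Hypothesis k0 : 0 < k.
Let nu := v / k%:C.
Hypothesis nuN : ~ nonpositive_integer (nu + 1).

(** The coefficients are normalized by their value at n = 0, which is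
    [bessel_scale] up to the power of t. *)
Definition bessel_coef n : R[i] :=
  ((- (c / (4 * k))) ^+ n)%:C / (pochhammer (nu + 1) n * (n`!)%:R).

Lemma bessel_coef0 : bessel_coef 0 = 1.
Proof. by rewrite /bessel_coef expr0 pochhammer0 fact0 mulr1 divr1. Qed.

Lemma normc_bessel_coef n : normc (bessel_coef n) =
  `|c / (4 * k)| ^+ n * (normc (pochhammer (nu + 1) n)^-1 / n`!%:R).
Proof.
rewrite /bessel_coef normcM normcC normrX normrN (invfM (pochhammer _ _)) normcM.
by rewrite (normcV n`!%:R) natrC normcC (ger0_norm (ler0n R n`!)).
Qed.

(** Bounding 1 / (nu + 1)_n by a constant leaves an exponential series. *)
Lemma cvg_bessel_coef (y : R) : 0 <= y ->
  cvgn (series (fun n => normc (bessel_coef n) * y ^+ n)).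
Proof.
move=> y0; have [D D0 Dn] := inv_pochhammer_bounded nuN.
have cexp := is_cvg_series_exp_coeff (`|c / (4 * k)| * y).
apply: (@series_le_cvg _ _ (D *: exp_coeff (`|c / (4 * k)| * y))) => [n|n|n|].
- by rewrite mulr_ge0 ?normc_ge0 ?exprn_ge0.
- rewrite /= mulr_ge0// /exp_coeff/= divr_ge0// exprn_ge0// mulr_ge0//.
- rewrite normc_bessel_coef -[X in _ <= X]/(D * ((`|c / (4 * k)| * y) ^+ n / n`!%:R)).
  rewrite exprMn mulrAC.
  have -> : D * (`|c / (4 * k)| ^+ n * y ^+ n / n`!%:R) =
            `|c / (4 * k)| ^+ n * y ^+ n * (D / n`!%:R) by ring.
  by rewrite ler_wpM2l ?mulr_ge0 ?exprn_ge0// ler_wpM2r.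
- exact: is_cvg_seriesZ.
Qed.

Lemma bessel_coef_ccvg (y : R) : 0 <= y ->
  ccvg (fun N => \sum_(0 <= n < N) bessel_coef n * (y ^+ n)%:C)
       (csum (fun n => bessel_coef n * (y ^+ n)%:C)).
Proof.
move=> y0; apply: ccvg_csum.
under eq_fun do rewrite normcM normcC ger0_norm ?exprn_ge0//.
exact: cvg_bessel_coef.
Qed.

Definition bessel_scale : R[i] := cpow (2 * k) (- nu) / Gamma (nu + 1).

Lemma kBessel_term n (t : R) : 0 < t ->
  ((- c) ^+ n)%:C / (kGamma k (n%:R * k%:C + v + k%:C) * (n`!)%:R)
    * cpow (1 / t / 2) ((2 * n)%:R + v / k%:C) =
  bessel_scale * cpow t (- nu) * (bessel_coef n * ((t ^- 2) ^+ n)%:C).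
Proof.
move=> t0; have kn0 : k%:C != 0 by rewrite fmorph_eq0 gt_eqF.
rewrite kGammaE//.
have -> : (n%:R * k%:C + v + k%:C) / k%:C = nu + 1 + n%:R by rewrite /nu; field.
rewrite GammaD//.
have -> : nu + 1 + n%:R - 1 = n%:R + nu by ring.
rewrite cpowD cpow_natr//.
have -> : 1 / t / 2 = (2 * t)^-1 by rewrite mul1r -invfM mulrC.
rewrite cpowV ?mulr_gt0// opprD cpowD cpowN cpow_natr ?mulr_gt0//.
rewrite /bessel_scale !cpowM// !cpowN /bessel_coef -/nu.
have := cpow_neq0 k nu; have := cpow_neq0 2 nu; have := cpow_neq0 t nu.
have := Gamma_neq0 nuN; have := pochhammer_neq0 n nuN.
have fn0 : n`!%:R != 0 :> R[i] by rewrite pnatr_eq0 -lt0n fact_gt0.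
rewrite (_ : (- (c / (4 * k))) ^+ n = (- c) ^+ n / (4 ^+ n * k ^+ n)); last first.
  by rewrite -mulNr expr_div_n exprMn.
rewrite (_ : (2 * t) ^+ (2 * n) = 4 ^+ n * t ^+ 2 ^+ n); last first.
  by rewrite exprM -exprMn; congr (_ ^+ n); ring.
rewrite exprVn !(rmorphM, fmorphV)/=.
move: (cpow k nu) (cpow 2 nu) (cpow t nu) (Gamma _) (pochhammer _ _) => A B C G P.
have k1 : (k ^+ n)%:C != 0 by rewrite fmorph_eq0 expf_neq0// gt_eqF.
have t1 : (t ^+ 2 ^+ n)%:C != 0 by rewrite fmorph_eq0 !expf_neq0// gt_eqF.
have f1 : (4 ^+ n : R)%:C != 0 by rewrite fmorph_eq0 expf_neq0// pnatr_eq0.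
move: ((- c) ^+ n)%:C (k ^+ n)%:C (t ^+ 2 ^+ n)%:C (4 ^+ n)%:C n`!%:R k1 t1 f1 fn0.
by move=> e1 e2 e3 e4 e5 k1 t1 f1 fn0 P0 G0 C0 B0 A0; field; rewrite ?C0 ?B0 ?A0 ?P0 ?G0 ?k1 ?t1 ?f1 ?fn0.
Qed.

Lemma kBesselE (t : R) : 0 < t ->
  kBessel k c v (1 / t) = bessel_scale * cpow t (- nu) *
    csum (fun n => bessel_coef n * ((t ^- 2) ^+ n)%:C).
Proof.
move=> t0; rewrite /kBessel; apply: csumE.
under eq_fun do under eq_bigr do rewrite kBessel_term//.
under eq_fun do rewrite -mulr_sumr.
apply: ccvgZl; apply: bessel_coef_ccvg.
by rewrite invr_ge0 exprn_ge0// ltW.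
Qed.

End BesselSeries.

(** * The fractional integral *)

Section BesselIntegral.
Variable R : realType.
Local Notation mu := (@lebesgue_measure R).
Variables (k c x : R) (alpha a v : R[i]).
Hypotheses (k0 : 0 < k) (x0 : 0 < x).
Let nu := v / k%:C.
Hypothesis nuN : ~ nonpositive_integer (nu + 1).
Let s := 1 - alpha - a + nu.
Let b := 1 - a + nu.
Let f (t : R) := cpow t (a - 1) * kBessel k c v (1 / t).
Let D : set R := `]x, +oo[%classic.
Let K0 := bessel_scale k v.
Let B := bessel_coef k c v.

Let cpowN_even n (t : R) : 0 < t -> cpow t (- (2 * n)%:R) = ((t ^- 2) ^+ n)%:C.
Proof. by move=> t0; rewrite cpowN cpow_natr// -fmorphV/= exprVn -exprM. Qed.

Let cpow_term n (t : R) : 0 < t ->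
  cpow t (- (s + (2 * n)%:R + alpha)) =
  cpow t (a - 1) * cpow t (- nu) * ((t ^- 2) ^+ n)%:C.
Proof.
move=> t0; rewrite (_ : - _ = (a - 1) + - nu + - (2 * n)%:R); last first.
  by rewrite /s; ring.
by rewrite (cpowD t (a - 1 - nu)) (cpowD t (a - 1)) cpowN_even.
Qed.

Lemma RL_integrandE (t : R) : 0 < t ->
  RL_right_integrand alpha f x t =
  cpow (t - x) (alpha - 1) * cpow t (a - 1) * (K0 * cpow t (- nu)) *
  csum (fun n => B n * ((t ^- 2) ^+ n)%:C).
Proof.
by move=> t0; rewrite /RL_right_integrand /f kBesselE// -/nu -/K0 -/B; ring.
Qed.

Section Convergent.
Hypotheses (alpha0 : 0 < Re alpha) (s0 : 0 < Re s).

Let g n (t : R) := cpow (t - x) (alpha - 1) * cpow t (- (s + (2 * n)%:R + alpha)).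

Let sn0 n : 0 < Re (s + (2 * n)%:R).
Proof. by rewrite ReD Re_natr ltr_wpDr. Qed.

Let ig n : cintegrable D (g n).
Proof. exact: cintegrable_beta. Qed.

Let b0 : 0 < Re b.
Proof.
have -> : b = s + alpha by rewrite /b /s; ring.
by rewrite ReD addr_gt0.
Qed.

Lemma cintegral_bessel_term n :
  cintegral D (g n) =
  cpow x (- s) * (Gamma_int alpha * Gamma_int s / Gamma_int b) *
  (((x ^- 2) ^+ n)%:C * (pochhammer s (2 * n) / pochhammer b (2 * n))).
Proof.
have := cintegral_beta x0 alpha0 (sn0 n); rewrite -/(g n) -/D.
have -> : s + (2 * n)%:R + alpha = b + (2 * n)%:R by rewrite /s /b; ring.
rewrite !Gamma_int_pochhammer//.
have -> : cpow x (- (s + (2 * n)%:R)) = cpow x (- s) * ((x ^- 2) ^+ n)%:C.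
  by rewrite opprD cpowD cpowN_even.
have Gb := Gamma_int_neq0 b0.
have Pb : pochhammer b (2 * n) != 0.
  exact/pochhammer_neq0/Re_gt0_not_nonpositive.
move=> E; apply: (mulfI (mulf_neq0 Pb Gb)); rewrite E.
by field; rewrite Gb Pb.
Qed.

(** For t > x one has t^(- 2 n) <= x^(- 2 n): the partial sums are dominated by
    the modulus of the term of index 0 times the constant sum of the
    |B n| x^(- 2 n). *)
Lemma RL_bessel_ccvg :
  cintegrable D (RL_right_integrand alpha f x) /\
  ccvg (fun N => \sum_(0 <= n < N) K0 * B n * cintegral D (g n))
       (cintegral D (RL_right_integrand alpha f x)).
Proof.
pose F N t := \sum_(0 <= n < N) K0 * B n * g n t.
have FE N t : 0 < t -> F N t =
    cpow (t - x) (alpha - 1) * cpow t (a - 1) * (K0 * cpow t (- nu)) *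
    \sum_(0 <= n < N) B n * ((t ^- 2) ^+ n)%:C.
  move=> t0; rewrite /F big_distrr/=; apply: eq_bigr => n _.
  by rewrite /g cpow_term//; ring.
have mD : measurable D by exact: measurable_itv.
have itvP t : D t -> x < t by rewrite /D/= in_itv/= andbT.
pose M : R := limn (series (fun n => normc (B n) * (x ^- 2) ^+ n)).
have x2 : 0 <= x ^- 2 by rewrite invr_ge0 exprn_ge0 ?ltW.
have cM : cvgn (series (fun n => normc (B n) * (x ^- 2) ^+ n)).
  exact: cvg_bessel_coef.
pose h (t : R) : R := normc K0 * M * normc (g 0%N t).
have [| | | | |ifx] := @cdominated_convergence R D F (RL_right_integrand alpha f x) h.
- exact: mD.
- move=> N; apply: cmeasurable_sum => n; apply: cmeasurableM.
    exact: cmeasurable_cst.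
  exact: cintegrable_measurable.
- move=> t /itvP xt; have t0 := lt_trans x0 xt.
  rewrite RL_integrandE//; under [X in ccvg X _]funext do rewrite FE//.
  apply: ccvgZl; apply: bessel_coef_ccvg => //.
  by rewrite invr_ge0 exprn_ge0 ?ltW.
- rewrite /h; under [X in integrable _ _ X]funext do rewrite /= EFinM.
  have i0 := cintegrable_normc mD (ig 0%N).
  exact: (@integrableZl _ _ _ mu D mD (normc K0 * M) _ i0).
- move=> N t /itvP xt; have t0 := lt_trans x0 xt.
  rewrite /F /h (le_trans (normc_sum _ _))//.
  have gE n : g n t = g 0%N t * ((t ^- 2) ^+ n)%:C.
    by rewrite /g !cpow_term// expr0 mulr1 !mulrA.
  have tx : t ^- 2 <= x ^- 2.
    by rewrite lef_pV2 ?posrE ?exprn_gt0// ler_pXn2r ?nnegrE ?ltW.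
  have t2 : 0 <= t ^- 2 by rewrite invr_ge0 exprn_ge0 ?ltW.
  apply: (@le_trans _ _ (\sum_(0 <= n < N) (normc K0 * normc (g 0%N t)) *
      (normc (B n) * (x ^- 2) ^+ n))).
    apply: ler_sum => n _; rewrite gE normcM (normcM K0) (normcM (g 0%N t)).
    rewrite normcC (ger0_norm (exprn_ge0 n t2)).
    rewrite -!mulrA ler_wpM2l ?normc_ge0// mulrCA ler_wpM2l ?normc_ge0//.
    by rewrite ler_wpM2l ?normc_ge0// lerXn2r.
  rewrite -mulr_sumr mulrAC ler_wpM2r ?normc_ge0// ler_wpM2l ?normc_ge0//.
  apply: (nondecreasing_cvgn_le (u_ := series _) _ cM).
  apply: nondecreasing_series => n _ _.
  by rewrite mulr_ge0 ?normc_ge0 ?exprn_ge0.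
move=> cF; split => //; move: cF; congr (ccvg _ _); apply/funext => N.
rewrite /F cintegral_sum//.
- by apply: eq_bigr => n _; rewrite cintegralZl.
- by move=> n; apply: cintegrableZl.
Qed.

Let hyper n : R[i] :=
  (\prod_(ai <- [:: s / 2; (s + 1) / 2]) pochhammer ai n) /
  (\prod_(bj <- [:: nu + 1; b / 2; (b + 1) / 2]) pochhammer bj n) *
  ((- (c / (4 * k * x ^+ 2)))%:C ^+ n / (n`!)%:R).

Let bessel_term_hyper n :
  K0 * B n * cintegral D (g n) =
  K0 * (cpow x (- s) * (Gamma_int alpha * Gamma_int s / Gamma_int b)) * hyper n.
Proof.
rewrite cintegral_bessel_term !pochhammer_double /hyper !big_cons !big_nil !mulr1.
have bN : forall m, pochhammer b m != 0.
  by move=> m; exact/pochhammer_neq0/Re_gt0_not_nonpositive.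
have := bN (2 * n)%N; rewrite pochhammer_double !mulf_eq0 !negb_or => /and3P[f0 p0 q0].
have nu0 := pochhammer_neq0 n nuN.
have fn0 : n`!%:R != 0 :> R[i] by rewrite pnatr_eq0 -lt0n fact_gt0.
rewrite /B /bessel_coef -/nu.
have -> : (- (c / (4 * k * x ^+ 2)))%:C ^+ n =
    ((- (c / (4 * k))) ^+ n)%:C * ((x ^- 2) ^+ n)%:C.
  rewrite -rmorphM -exprMn -rmorphXn; congr ((_ ^+ n)%:C).
  by rewrite mulNr (invfM (4 * k)) mulrA.
move: (pochhammer (s / 2) n) (pochhammer ((s + 1) / 2) n) => p1 p2.
move: f0 p0 q0 nu0 fn0.
move: (pochhammer (b / 2) n) (pochhammer ((b + 1) / 2) n) (pochhammer (nu + 1) n).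
move: (4 ^+ n) n`!%:R ((- (c / (4 * k))) ^+ n)%:C ((x ^- 2) ^+ n)%:C.
move: (Gamma_int alpha * Gamma_int s / Gamma_int b) (cpow x (- s)) => G X.
move=> e1 e2 e3 e4 q1 q2 q3 f0 p0 q0 nu0 fn0.
by field; rewrite f0 p0 q0 nu0 fn0.
Qed.

Lemma RL_bessel :
  RL_right alpha f x =
  K0 * cpow x (- s) * (Gamma s / Gamma b) *
  hypergeometric [:: s / 2; (s + 1) / 2] [:: nu + 1; b / 2; (b + 1) / 2]
    (- (c / (4 * k * x ^+ 2)))%:C.
Proof.
have [_ cI] := RL_bessel_ccvg; rewrite /RL_right -/D.
move: (cintegral D (RL_right_integrand alpha f x)) cI => I cI.
have Ga := Gamma_int_neq0 alpha0; have Gs := Gamma_int_neq0 s0.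
have Gb := Gamma_int_neq0 b0; have X0 := cpow_neq0 x (- s).
have KK0 : K0 != 0.
  by rewrite mulf_neq0 ?cpow_neq0// invr_neq0// Gamma_neq0.
pose KK := K0 * (cpow x (- s) * (Gamma_int alpha * Gamma_int s / Gamma_int b)).
have KKn0 : KK != 0.
  exact: mulf_neq0 KK0 (mulf_neq0 X0 (mulf_neq0 (mulf_neq0 Ga Gs) (invr_neq0 Gb))).
have -> : hypergeometric [:: s / 2; (s + 1) / 2] [:: nu + 1; b / 2; (b + 1) / 2]
    (- (c / (4 * k * x ^+ 2)))%:C = KK^-1 * I.
  apply: csumE; move: (ccvgZl KK^-1 cI); congr (ccvg _ _); apply/funext => N.
  rewrite mulr_sumr; apply: eq_bigr => n _.
  by rewrite bessel_term_hyper -/KK mulKf.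
rewrite !GammaE// /KK.
move: (Gamma_int alpha) (Gamma_int s) (Gamma_int b) (cpow x (- s)) Ga Gs Gb X0.
move: K0 KK0 => K1 K10 ga gs gb X *.
by field; do ?[apply/andP; split].
Qed.

End Convergent.

Lemma bessel_scale_neq0 : K0 != 0.
Proof. by rewrite mulf_neq0 ?cpow_neq0// invr_neq0// Gamma_neq0. Qed.

(* Integrating delta / t over [T, Y] gives delta (ln Y - ln T), which exceeds
   any bound as Y grows. *)
Let inv_not_integrable (h : R -> R) (delta T : R) : 0 < delta -> x < T ->
  (forall t, T <= t -> delta / t <= h t) -> ~ mu.-integrable D (EFin \o h).
Proof.
move=> d0 xT hT ih; have mD : measurable D by exact: measurable_itv.
have T0 := lt_trans x0 xT.
pose I : R := fine (\int[mu]_(t in D) `|(h t)%:E|)%E.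
have IE : (\int[mu]_(t in D) `|(h t)%:E| = I%:E)%E.
  rewrite /I fineK// ge0_fin_numE; first by have /integrableP[] := ih.
  exact: integral_ge0.
have bound Y : T < Y -> delta * (ln Y - ln T) <= I.
  move=> TY.
  have FTC : (\int[mu]_(t in `[T, Y]) (t^-1)%:E = (ln Y)%:E - (ln T)%:E)%E.
    have dln t : T <= t -> is_derive t 1 (@ln R) t^-1.
      by move=> Tt; apply: is_derive1_ln; exact: lt_le_trans Tt.
    apply: continuous_FTC2 => //.
    - apply: continuous_in_subspaceT => t; rewrite inE/= in_itv/= => /andP[Tt _].
      by apply: inv_continuous; rewrite gt_eqF// (lt_le_trans T0).
    - split.
      + move=> t; rewrite in_itv/= => /andP[/ltW/dln ? _]; exact: ex_derive.
      + by apply/cvg_at_right_filter/continuous_ln.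
      + by apply/cvg_at_left_filter/continuous_ln/(lt_trans T0).
    - move=> t; rewrite in_itv/= => /andP[/ltW/dln dt _].
      by rewrite derive1E (@derive_val _ _ _ _ _ _ _ dt).
  have minv : measurable_fun `[T, Y] (fun t => (t^-1)%:E).
    apply/measurable_EFinP; apply: subspace_continuous_measurable_fun => //.
    apply: continuous_in_subspaceT => t; rewrite inE/= in_itv/= => /andP[Tt _].
    by apply: inv_continuous; rewrite gt_eqF// (lt_le_trans T0).
  rewrite -lee_fin EFinM EFinB -FTC -IE -ge0_integralZl_EFin ?(ltW d0)//; last first.
    move=> t /=; rewrite in_itv/= => /andP[Tt _].
    by rewrite lee_fin invr_ge0 (le_trans (ltW T0)).
  have mh : measurable_fun D (fun t => `|(h t)%:E|%E).
    by apply: measurableT_comp => //; have /integrableP[] := ih.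
  have TYD : `[T, Y]%classic `<=` D.
    move=> t /=; rewrite /D/= !in_itv/= andbT => /andP[Tt _].
    exact: lt_le_trans Tt.
  apply: (@le_trans _ _ (\int[mu]_(t in `[T, Y]) `|(h t)%:E|)%E); last first.
    by apply: ge0_subset_integral => //.
  apply: ge0_le_integral => //.
  - move=> t /=; rewrite in_itv/= => /andP[Tt _].
    by rewrite mule_ge0 ?lee_fin ?invr_ge0 ?(ltW d0)// (le_trans (ltW T0)).
  - exact: measurable_funeM.
  - exact: measurable_funS mh.
  - move=> t /=; rewrite in_itv/= => /andP[Tt _].
    by rewrite -EFinM lee_fin (le_trans (hT _ Tt))// ler_norm.
have I0 : 0 <= I by rewrite -lee_fin -IE integral_ge0.
have := bound (T * expR ((I + 1) / delta)).
rewrite ltr_pMr// expR_gt1 divr_gt0 ?ltr_wpDl// => /(_ isT).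
rewrite lnM ?posrE ?expR_gt0// expRK addrAC subrr add0r.
rewrite mulrCA divff ?gt_eqF// mulr1.
by rewrite -lerBrDl subrr ler10.
Qed.

(* The coefficient of index 0 is 1 and for y <= 1 the other terms add up to at
   most y M. *)
Let csum_ge_half : exists2 M : R, 0 <= M & forall y : R, 0 <= y <= 1 -> y * M <= 2^-1 ->
  2^-1 <= Re (csum (fun n => B n * (y ^+ n)%:C)).
Proof.
have cM : cvgn (series (fun n => normc (B n) * 1 ^+ n)).
  exact: cvg_bessel_coef.
have ndM : nondecreasing_seq (series (fun n => normc (B n) * 1 ^+ n)).
  by apply: nondecreasing_series => n _ _; rewrite mulr_ge0 ?normc_ge0 ?exprn_ge0.
pose M : R := limn (series (fun n => normc (B n) * 1 ^+ n)).
have leM N : \sum_(0 <= n < N) normc (B n) <= M.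
  rewrite (eq_bigr (fun n => normc (B n) * 1 ^+ n)).
    exact: (nondecreasing_cvgn_le ndM cM N).
  by move=> n _; rewrite expr1n mulr1.
exists M.
  by apply: le_trans (leM 0%N); rewrite big_geq.
move=> y /andP[y0 y1] yM.
have [cRe _] : ccvg (fun N => \sum_(0 <= n < N) B n * (y ^+ n)%:C)
    (csum (fun n => B n * (y ^+ n)%:C)) by exact: bessel_coef_ccvg.
apply: (cvgr_to_ge cRe); near=> N.
have N0 : (0 < N)%N by near: N; exact: nbhs_infty_gt.
rewrite -(prednK N0) big_nat_recl// /B bessel_coef0 expr0 mulr1 ReD.
set S := \sum_(_ <= _ < _) _.
have SM : normc S <= y * M.
  apply: le_trans (normc_sum _ _) _.
  apply: (@le_trans _ _ (\sum_(0 <= i < N.-1) y * normc (B i.+1))).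
    apply: ler_sum => i _; rewrite normcM normcC ger0_norm ?exprn_ge0//.
    by rewrite mulrC ler_wpM2r ?normc_ge0// exprS ler_piMr// exprn_ile1.
  rewrite -mulr_sumr ler_wpM2l//; apply: le_trans (leM N).
  by rewrite -(prednK N0) big_nat_recl// lerDr normc_ge0.
have : - Re S <= 2^-1.
  by rewrite (le_trans (ler_norm _))// normrN (le_trans (normc_Re _))// (le_trans SM).
by rewrite /=; lra.
Unshelve. all: by end_near.
Qed.

(** For large t the sum of the series has modulus at least 1 / 2 and t - x is
    comparable to t, so the integrand has modulus at least a multiple of
    t^(- 1 - Re s), which dominates 1 / t. *)
Lemma RL_bessel_undefined : Re s <= 0 ->
  ~ cintegrable D (RL_right_integrand alpha f x).
Proof.
move=> s0 ig.
have ing := cintegrable_normc (measurable_itv _) ig.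
have [M M0 HM] := csum_ge_half.
pose e := Re alpha - 1.
pose delta := normc K0 * ((2^-1 `^ `|e|) * 2^-1).
have d0 : 0 < delta.
  by rewrite !mulr_gt0 ?normc_gt0 ?bessel_scale_neq0// powR_gt0.
(* Beyond T one has t - x >= t / 2, t >= 1 and t^(-2) M <= 1 / 2. *)
pose T := 2 * x + 2 * M + 1.
apply: (inv_not_integrable d0 (T := T) _ _ ing).
  by rewrite /T; move: x0 M0; lra.
move=> t Tt.
have [t1 t2x tM] : [/\ 1 <= t, 2 * x <= t & 2 * M <= t].
  by move: Tt; rewrite /T; move: x0 M0 => *; split; lra.
have t0 : 0 < t by exact: lt_le_trans t1.
have xt : x < t by move: x0; lra.
have tx0 : 0 < t - x by rewrite subr_gt0.
have /HM HS : 0 <= t ^- 2 <= 1.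
  by rewrite invr_ge0 exprn_ge0 ?(ltW t0)//= invf_le1 ?exprn_gt0// exprn_ege1.
have {HS} S2 : 2^-1 <= normc (csum (fun n => B n * ((t ^- 2) ^+ n)%:C)).
  apply: le_trans (normc_Re _); apply: le_trans (ler_norm _); apply: HS.
  rewrite mulrC ler_pdivrMr ?exprn_gt0// expr2.
  rewrite (le_trans (_ : M <= 2^-1 * t)) ?ler_wpM2l ?ler_peMl ?(ltW t0)//.
  by rewrite mulrC ler_pdivlMr// mulrC.
rewrite RL_integrandE//.
move: (csum _) S2 => S S2.
have -> : cpow (t - x) (alpha - 1) * cpow t (a - 1) * (K0 * cpow t (- nu)) * S =
    K0 * (cpow (t - x) (alpha - 1) * (cpow t (a - 1 - nu) * S)).
  by rewrite (cpowD t (a - 1)); ring.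
have nM (p q r w : R[i]) :
    normc (p * (q * (r * w))) = normc p * (normc q * (normc r * normc w)).
  by rewrite !normcM.
rewrite nM.
rewrite (normc_cpow _ tx0) (normc_cpow _ t0).
have -> : Re (alpha - 1) = e by rewrite /e ReD ReN.
have -> : Re (a - 1 - nu) = - e + (- Re s - 1).
  by rewrite /e /s !ReD !ReN /=; ring.
rewrite (gt0_powRD (- e) (- Re s - 1) t0).
(* With r = (t - x) / t in [1/2, 1], r^e >= r^|e| >= (1/2)^|e| for both signs
   of e. *)
have q1 : 2^-1 `^ `|e| * t `^ e <= (t - x) `^ e.
  pose r := (t - x) / t.
  have r1 : 2^-1 <= r by rewrite /r ler_pdivlMr//; move: t2x; lra.
  have r2 : r <= 1 by rewrite /r ler_pdivrMr// mul1r; move: x0; lra.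
  have r0 : 0 < r by rewrite divr_gt0.
  rewrite [X in _ <= X `^ _](_ : _ = r * t); last by rewrite /r divfK// gt_eqF.
  rewrite (powRM _ (ltW r0) (ltW t0)) ler_wpM2r ?powR_ge0//.
  apply: (@le_trans _ _ (r `^ `|e|)).
    by apply: ge0_ler_powR => //; rewrite nnegrE// ltW.
  by apply: ger_powR; rewrite ?r0// ler_norm.
have q2 : t^-1 <= t `^ (- Re s - 1).
  by rewrite -(powR_inv1 (ltW t0)) ler_powR// lerBrDr addNr oppr_ge0.
have te : t `^ e * t `^ (- e) = 1 by rewrite -gt0_powRD// subrr powRr0.
rewrite /delta -!mulrA ler_wpM2l ?normc_ge0//.
apply: (@le_trans _ _ ((2^-1 `^ `|e| * t `^ e) * (t `^ (- e) * (t^-1 * 2^-1)))).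
  by rewrite -[leRHS]mulrA (mulrA (t `^ e)) te mul1r (mulrC t^-1).
apply: ler_pM => //; rewrite ?mulr_ge0 ?powR_ge0 ?invr_ge0 ?(ltW t0)//.
rewrite ler_wpM2l ?powR_ge0//.
by apply: ler_pM => //; rewrite invr_ge0 ltW.
Qed.

End BesselIntegral.

Theorem corollary3p5 (R : realType) (k c x : R) (alpha lambda v : R[i])
  (k_gt0 : 0 < k) (x_gt0 : 0 < x)
  (v_gt : -1 < complex.Re v)
  (alpha_gt0 : 0 < complex.Re alpha)
  (alpha_lt : complex.Re alpha < 1 - complex.Re (lambda - v))
  (no_pole : forall n : nat,
     lambda / k%:C - v / k%:C + alpha <> n.+1%:R)
  (lower1 : ~ nonpositive_integer (v / k%:C + 1))
  (lower2 : ~ nonpositive_integer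
     (1 / 2 - lambda / (2 * k%:C) + v / (2 * k%:C)))
  (lower3 : ~ nonpositive_integer
     (1 - lambda / (2 * k%:C) + v / (2 * k%:C))) :
  let f := fun t : R => cpow t (lambda / k%:C - 1) * kBessel k c v (1 / t) in
  (complex.Re (lambda / k%:C - v / k%:C + alpha) < 1 ->
     RL_right_defined alpha f x) /\
  (RL_right_defined alpha f x ->
   RL_right alpha f x =
     cpow x (lambda / k%:C - v / k%:C + alpha - 1) / cpow (2 * k) (v / k%:C)
     * (Gamma (1 - alpha - lambda / k%:C + v / k%:C)
        / (Gamma (1 - lambda / k%:C + v / k%:C) * Gamma (v / k%:C + 1)))
     * hypergeometric
         [:: (- alpha + 1) / 2 - lambda / (2 * k%:C) + v / (2 * k%:C);
             (- alpha + 2) / 2 - lambda / (2 * k%:C) + v / (2 * k%:C)]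
         [:: v / k%:C + 1;
             1 / 2 - lambda / (2 * k%:C) + v / (2 * k%:C);
             1 - lambda / (2 * k%:C) + v / (2 * k%:C)]
         (- (c / (4 * k * x ^+ 2)))%:C).
Proof.
have kn0 : k%:C != 0 :> R[i] by rewrite fmorph_eq0 gt_eqF.
move=> f.
pose s := 1 - alpha - lambda / k%:C + v / k%:C.
have ReE : Re s = 1 - Re (lambda / k%:C - v / k%:C + alpha).
  by rewrite /s !ReD !ReN /=; ring.
have convergent : 0 < Re s -> RL_right_defined alpha f x.
  by move=> s0; have [] := RL_bessel_ccvg c k_gt0 x_gt0 lower1 alpha_gt0 s0.
split; first by move=> h; apply: convergent; rewrite ReE subr_gt0.
(* Convergence of the integral already forces Re s > 0. *)
move=> fdef; have s0 : 0 < Re s.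
  rewrite ltNge; apply/negP => s_le0.
  exact: (RL_bessel_undefined k_gt0 x_gt0 lower1 s_le0 fdef).
rewrite (RL_bessel c k_gt0 x_gt0 lower1 alpha_gt0 s0) -/s.
rewrite /bessel_scale.
have -> : - s = lambda / k%:C - v / k%:C + alpha - 1 by rewrite /s; ring.
have -> : (- alpha + 1) / 2 - lambda / (2 * k%:C) + v / (2 * k%:C) = s / 2.
  by rewrite /s; field.
have -> : (- alpha + 2) / 2 - lambda / (2 * k%:C) + v / (2 * k%:C) = (s + 1) / 2.
  by rewrite /s; field.
have -> : 1 / 2 - lambda / (2 * k%:C) + v / (2 * k%:C) =
    (1 - lambda / k%:C + v / k%:C) / 2 by field.
have -> : 1 - lambda / (2 * k%:C) + v / (2 * k%:C) =
    (1 - lambda / k%:C + v / k%:C + 1) / 2 by field.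
rewrite cpowN; congr (_ * _).
by rewrite (invfM (Gamma (1 - _ + _))); ring.
Qed.
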